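(* Let $\Gamma=(V,E,s,t)$ be a multiquiver, $\gamma:\mathbb{Z}V\to\mathbb{Z}E$ its incidence matrix, $\mathcal{A}(\Gamma)$ the corresponding twisted generalized Weyl (TGW) algebra, and $\varphi_\Gamma:\mathcal{A}(\Gamma)\to A_E(\Bbbk)$ the canonical representation by differential operators. Then the following statements are equivalent: (i) $\varphi_\Gamma$ is injective; (ii) $\gamma$ is injective; (iii) $R_E$ is a maximal commutative subalgebra of $\mathcal{A}(\Gamma)$; (iv) no connected component of $\Gamma$ is in equilibrium.
   Context: $\Bbbk$ is a field of characteristic zero; rings are associative and unital; $\mathbb{Z}X$ denotes the free abelian group on a set $X$. TGW algebras. A TGW datum $(R,\sigma,t)$ with index set $I$: a $\Bbbk$-algebra $R$, commuting $\Bbbk$-algebra automorphisms $\sigma=(\sigma_i)_{i\in I}$ of $R$, nonzero central elements $t=(t_i)_{i\in I}$ of $R$. Given $\mu=(\mu_{ij})_{i\ne j}$ with $\mu_{ij}\in\Bbbk\setminus\{0\}$, $\mathcal{C}_\mu(R,\sigma,t)$ is the free $R$-ring on symbols $X_i,Y_i$ ($i\in I$) modulo the relations $X_ir=\sigma_i(r)X_i$, $Y_ir=\sigma_i^{-1}(r)Y_i$, $Y_iX_i=t_i$, $X_iY_i=\sigma_i(t_i)$ ($r\in R$, $i\in I$), $X_iY_j=\mu_{ij}Y_jX_i$ ($i\neq j$). It is $\mathbb{Z}I$-graded by $\deg X_i=i$, $\deg Y_i=-i$, $\deg r=0$. The TGW algebra $\mathcal{A}_\mu(R,\sigma,t)$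 is the quotient of $\mathcal{C}_\mu(R,\sigma,t)$ by the sum of all graded ideals having zero intersection with the degree-zero component; it is $\mathbb{Z}I$-graded. Multiquivers. A multiquiver $\Gamma=(V,E,s,t)$ consists of sets $V$ (vertices), $E$ (edges) and functions $s,t:E\to (V\times\mathbb{Z}_{>0})\cup\{\emptyset\}$ such that (no loops) if $s(e)=(u,m)$ and $t(e)=(v,n)$ then $u\ne v$; and (local finiteness) for each $v\in V$ only finitely many $e$ have $s(e)\in\{v\}\times\mathbb{Z}_{>0}$ or $t(e)\in\{v\}\times\mathbb{Z}_{>0}$. If $s(e)=(v,n)$ (resp. $t(e)=(v,n)$), $v$ is the source (resp. target) of $e$, is incident to $e$, and $n$ is the outgoing (resp. incoming) multiplicity of $e$ at $v$. An edge $e$ with $s(e)=\emptyset$ or $t(e)=\emptyset$ is called a leaf. The incidence matrix is $\gamma:\mathbb{Z}V\to\mathbb{Z}E$, $\gamma(v)=\sum_{e\in E}\gamma_{ev}e$, where $\gamma_{ev}=n$ if $t(e)=(v,n)$, $\gamma_{ev}=-n$ if $s(e)=(v,n)$, and $\gamma_{ev}=0$ otherwise. $\mathcal{A}(\Gamma)$ is the TGW algebra $\mathcal{A}_\mu(R_E,\sigma^\Gamma,t^\Gamma)$ with index set $V$, where all $\mu_{ij}=1$, $R_E=\Bbbk[u_e\mid e\in E]$ (polynomial algebra), $\sigma_v(u_e)=u_e-\gamma_{ev}$, $t_v=\prod_{e\in E}u_{ev}$ with $u_{ev}=u_e(u_e+1)\cdots(u_e+\gamma_{ev}-1)$ if $\gamma_{ev}>0$,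 $u_{ev}=1$ if $\gamma_{ev}=0$, $u_{ev}=(u_e-1)(u_e-2)\cdots(u_e-|\gamma_{ev}|)$ if $\gamma_{ev}<0$. The canonical map $R_E\to\mathcal{A}(\Gamma)$ is injective, and $R_E$ is identified with its image. $A_E(\Bbbk)$ is the Weyl algebra: generators $x_e,y_e$ ($e\in E$), relations $[x_e,x_{e'}]=[y_e,y_{e'}]=0$, $[y_e,x_{e'}]=\delta_{ee'}$. For $k=\sum k_ee\in\mathbb{Z}E$ put $z^k=\prod_e z_e^{(k_e)}$ with $z_e^{(p)}=x_e^p$ if $p\ge0$ and $z_e^{(p)}=y_e^{-p}$ if $p<0$. The canonical representation $\varphi_\Gamma:\mathcal{A}(\Gamma)\to A_E(\Bbbk)$ is the algebra homomorphism with $\varphi_\Gamma(X_v)=z^{\gamma(v)}$, $\varphi_\Gamma(Y_v)=z^{-\gamma(v)}$, $\varphi_\Gamma(u_e)=y_ex_e$. Cycles and equilibrium. A subgraph of $\Gamma$ is given by subsets $V'\subseteq V$, $E'\subseteq E$ with $s'(e)=s(e)$ if the source of $e$ lies in $V'$ and $s'(e)=\emptyset$ otherwise, and likewise for $t'$. A multiquiver is a directed cycle if for some $n\ge1$ one can write $V=\{v_1,\dots,v_n\}$, $E=\{e_1,\dots,e_n\}$ (distinct elements) with $s(e_i)=(v_i,n_i)$, $t(e_i)=(v_{i+1},m_i)$, $v_{n+1}=v_1$. It is balanced if $\prod n_i=\prod m_i$. Two multiquivers are sign-equivalent if they become isomorphic after reversing some edges (swapping $s(e)$ and $t(e)$).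 An NND (not necessarily directed) cycle is a multiquiver sign-equivalent to a directed cycle; it is balanced if it is sign-equivalent to a balanced directed cycle. A cycle in $\Gamma$ is a subgraph of $\Gamma$ that is a cycle. Connected components are those of the underlying undirected graph (an edge with neither source nor target forms its own component). A connected component is in equilibrium if it has finitely many vertices, no leaves, and every NND cycle in it is balanced. *)

(* Defs.v *)
From HB Require Import structures.
From Stdlib Require Import Relation_Operators.
From mathcomp Require Import all_boot all_order all_algebra.
From mathcomp Require Import finmap.
From mathcomp Require Import boolp classical_sets functions cardinality.
From mathcomp.multinomials Require Import monalg.

Set Implicit Arguments.
Unset Strict Implicit.
Unset Printing Implicit Defensive.

Import GRing.Theory.

Local Open Scope classical_set_scope.
Local Open Scope ring_scope.
Local Open Scope quotient_scope.

(* [algType K] requires [1 != 0], which a presentation by generators and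
   relations does not provide. A [pzAlgType K] is a possibly zero algebra over
   the commutative ring K, given by its structure map from K to its center. *)
HB.mixin Record isPzAlg (K : comPzRingType) A of GRing.PzRing A := {
  scal : K -> A;
  scal1 : scal 1 = 1;
  scalD : forall c d, scal (c + d) = scal c + scal d;
  scalM : forall c d, scal (c * d) = scal c * scal d;
  scal_central : forall c x, scal c * x = x * scal c
}.

#[short(type="pzAlgType")]
HB.structure Definition PzAlg (K : comPzRingType) :=
  {A of GRing.PzRing A & isPzAlg K A}.

Section MalgPzAlg.
Variables (K : comNzRingType) (M : monomType).

Fact malgC_central (c : K) (x : {malg K[M]}) : c%:MP * x = x * c%:MP.
Proof.
rewrite !malgM_def fgmulUg fgmulgU; apply: eq_bigr => k _.
by rewrite mul1m mulm1 mulrC.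
Qed.

HB.instance Definition _ := isPzAlg.Build K {malg K[M]}
  (rmorph1 _) (rmorphD _) (rmorphM _) malgC_central.
End MalgPzAlg.

Section Ideals.
Variables (K : comPzRingType) (A : pzAlgType K).

Record ideal := Ideal {
  ideal_set :> A -> Prop;
  ideal0 : ideal_set 0;
  idealD : forall x y, ideal_set x -> ideal_set y -> ideal_set (x + y);
  idealM : forall a x b, ideal_set x -> ideal_set (a * x * b)
}.

#[local] Obligation Tactic := idtac.

Program Definition ideal_gen (S : set A) : ideal :=
  @Ideal [set x | forall J : ideal, (forall y, S y -> J y) -> J x] _ _ _.
Next Obligation. by move=> S J _; exact: ideal0. Qed.
Next Obligation. by move=> S x y Sx Sy J SJ; apply: idealD; [exact: Sx|exact: Sy]. Qed.
Next Obligation. by move=> S a x b Sx J SJ; apply: idealM; exact: Sx. Qed.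

Program Definition ideal_sum (P : set ideal) : ideal :=
  @Ideal [set x | exists2 s : seq A,
            (forall y, y \in s -> exists2 J : ideal, P J & J y)
            & x = \sum_(y <- s) y] _ _ _.
Next Obligation. by move=> P; exists [::] => //; rewrite big_nil. Qed.
Next Obligation.
move=> P x y [s Ps ->] [t Pt ->]; exists (s ++ t); last by rewrite big_cat.
by move=> z; rewrite mem_cat => /orP[/Ps|/Pt].
Qed.
Next Obligation.
move=> P a x b [s Ps ->]; exists [seq a * y * b | y <- s].
  by move=> z /mapP[y /Ps[J PJ Jy] ->]; exists J => //; exact: idealM.
by rewrite big_map mulr_sumr mulr_suml.
Qed.

Definition in_ideal (J : ideal) (x : A) : bool := `[< J x >].

Fact in_ideal_zmod_closed J : zmod_closed (in_ideal J).
Proof.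
split=> [|x y]; rewrite !unfold_in; first by apply/asboolP; exact: ideal0.
move=> /asboolP Jx /asboolP Jy; apply/asboolP; apply: idealD => //.
by have := idealM (-1) 1 Jy; rewrite mulr1 mulN1r.
Qed.

HB.instance Definition _ J :=
  GRing.isZmodClosed.Build A (in_ideal J) (in_ideal_zmod_closed J).

Definition ideal_zmod J : zmodClosed A := GRing.ZmodClosed.clone A (in_ideal J) _.

Definition quot_alg J := Quotient.quot (ideal_zmod J).

HB.instance Definition _ J := Choice.on (quot_alg J).
HB.instance Definition _ J := GRing.Zmodule.on (quot_alg J).
HB.instance Definition _ J := EqQuotient.on (quot_alg J).
HB.instance Definition _ J := ZmodQuotient.on (quot_alg J).

Section QuotientRing.
Variable J : ideal.
Local Notation Q := (quot_alg J).

Definition quot_pi (x : A) : Q := \pi_Q x.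
Definition quot_repr (q : Q) : A := repr q.

Lemma quot_reprK : cancel quot_repr quot_pi.
Proof. exact: reprK. Qed.

Lemma quot_pi_eq x y : quot_pi x = quot_pi y <-> J (x - y).
Proof.
rewrite /quot_pi; split=> [/eqP|Jxy]; last apply/eqP.
  by rewrite -Quotient.idealrBE => /asboolP.
by rewrite -Quotient.idealrBE; apply/asboolP.
Qed.

Lemma quot_piD x y : quot_pi (x + y) = quot_pi x + quot_pi y.
Proof. exact: (raddfD (\pi_Q)). Qed.

Definition quot_mul (p q : Q) : Q := quot_pi (quot_repr p * quot_repr q).

Fact quot_mulE x y : quot_mul (quot_pi x) (quot_pi y) = quot_pi (x * y).
Proof.
apply/quot_pi_eq; set x' := quot_repr _; set y' := quot_repr _.
have Jx : J (x' - x) by apply/quot_pi_eq; rewrite quot_reprK.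
have Jy : J (y' - y) by apply/quot_pi_eq; rewrite quot_reprK.
rewrite (_ : _ - _ = 1 * (x' - x) * y' + x * (y' - y) * 1).
  by apply: idealD; exact: idealM.
by rewrite mul1r mulr1 mulrBl mulrBr addrA subrK.
Qed.

Fact quot_mulA : associative quot_mul.
Proof.
move=> p q r; rewrite -(quot_reprK p) -(quot_reprK q) -(quot_reprK r).
by rewrite (quot_mulE (quot_repr q)) (quot_mulE (quot_repr p)) !quot_mulE mulrA.
Qed.

Fact quot_mul1q : left_id (quot_pi 1) quot_mul.
Proof. by move=> p; rewrite -(quot_reprK p) quot_mulE mul1r. Qed.

Fact quot_mulq1 : right_id (quot_pi 1) quot_mul.
Proof. by move=> p; rewrite -(quot_reprK p) quot_mulE mulr1. Qed.

Fact quot_mulDl : left_distributive quot_mul +%R.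
Proof.
move=> p q r; rewrite -(quot_reprK p) -(quot_reprK q) -(quot_reprK r).
by rewrite -quot_piD !quot_mulE mulrDl quot_piD.
Qed.

Fact quot_mulDr : right_distributive quot_mul +%R.
Proof.
move=> p q r; rewrite -(quot_reprK p) -(quot_reprK q) -(quot_reprK r).
by rewrite -quot_piD !quot_mulE mulrDr quot_piD.
Qed.

HB.instance Definition _ := GRing.Zmodule_isPzRing.Build Q
  quot_mulA quot_mul1q quot_mulq1 quot_mulDl quot_mulDr.

Lemma quot_piM x y : quot_pi (x * y) = quot_pi x * quot_pi y.
Proof. by rewrite -quot_mulE. Qed.

Definition quot_scal (c : K) : Q := quot_pi (scal c).

Fact quot_scal1 : quot_scal 1 = 1.
Proof. by rewrite /quot_scal scal1. Qed.

Fact quot_scalD c d : quot_scal (c + d) = quot_scal c + quot_scal d.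
Proof. by rewrite /quot_scal scalD quot_piD. Qed.

Fact quot_scalM c d : quot_scal (c * d) = quot_scal c * quot_scal d.
Proof. by rewrite /quot_scal scalM quot_piM. Qed.

Fact quot_scal_central c (p : Q) : quot_scal c * p = p * quot_scal c.
Proof. by rewrite -(quot_reprK p) /quot_scal -!quot_piM scal_central. Qed.

HB.instance Definition _ := isPzAlg.Build K Q
  quot_scal1 quot_scalD quot_scalM quot_scal_central.
End QuotientRing.
End Ideals.

Definition alg_morphism (K : comPzRingType) (A B : pzAlgType K) (f : A -> B) : Prop :=
  [/\ forall c, f (scal c) = scal c, {morph f : x y / x + y}
    & {morph f : x y / x * y}].

Section Subalgebras.
Variables (K : comPzRingType) (A : pzAlgType K).

Definition subalgebra (S : set A) : Prop :=
  [/\ forall c, S (scal c), forall x y, S x -> S y -> S (x + y)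
    & forall x y, S x -> S y -> S (x * y)].

Definition comm_subalgebra (S : set A) : Prop :=
  subalgebra S /\ forall x y, S x -> S y -> x * y = y * x.

Definition max_comm_subalgebra (S : set A) : Prop :=
  comm_subalgebra S /\
  forall T, comm_subalgebra T -> S `<=` T -> T = S.
End Subalgebras.

Section FreeAlgebra.
Variables (K : comNzRingType) (G : choiceType).

Definition free_alg := {malg K[{fmonom G}]}.
HB.instance Definition _ := PzAlg.on free_alg.

Definition free_gen (g : G) : free_alg := << fmu g >>.

Definition free_eval (B : pzAlgType K) (h : G -> B) (f : free_alg) : B :=
  \sum_(w <- msupp f) scal f@_w * \prod_(g <- (w : seq G)) h g.

Definition presented_alg (rel : free_alg -> free_alg -> Prop) : pzAlgType K :=
  quot_alg (ideal_gen [set fg.1 - fg.2 | fg in [set fg | rel fg.1 fg.2]]).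
End FreeAlgebra.

Section PolynomialAlgebra.
Variables (K : comNzRingType) (E : choiceType).

Definition poly_alg := {malg K[{cmonom E}]}.
HB.instance Definition _ := GRing.ComNzRing.on poly_alg.
HB.instance Definition _ := PzAlg.on poly_alg.

Definition poly_var (e : E) : poly_alg := << ucm e >>.

Definition poly_eval (B : pzAlgType K) (h : E -> B) (p : poly_alg) : B :=
  \sum_(m <- msupp p) scal p@_m * \prod_(e <- finsupp m) h e ^+ m e.
End PolynomialAlgebra.

Section PolynomialMorphisms.
Variables (K : comNzRingType) (E : choiceType).
Local Notation P := (poly_alg K E).

Section Evaluation.
Variables (B : comNzRingType) (h : E -> B).

Definition monom_eval (m : {cmonom E}) : B := \prod_(e <- finsupp m) h e ^+ m e.

Lemma monom_evalEw (d : {fset E}) (m : {cmonom E}) :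
  (finsupp m `<=` d)%fset -> monom_eval m = \prod_(e <- d) h e ^+ m e.
Proof.
move=> le; rewrite /monom_eval (big_fset_incl _ le) //= => e _.
by rewrite memNfinsupp => /eqP ->; rewrite expr0.
Qed.

Fact monom_eval_mmorphism : mmorphism monom_eval.
Proof.
split=> [m1 m2|]; last by rewrite /monom_eval mdom1 big_seq_fset0.
rewrite (monom_evalEw (fsubsetUl (finsupp m1) (finsupp m2))).
rewrite (monom_evalEw (fsubsetUr (finsupp m1) (finsupp m2))).
rewrite -big_split /= /monom_eval mdomD; apply: eq_bigr => e _.
by rewrite cmM exprD.
Qed.

HB.instance Definition _ := isMultiplicative.Build _ _ monom_eval monom_eval_mmorphism.

Lemma monom_evalU e : monom_eval (ucm e) = h e.
Proof. by rewrite /monom_eval mdomU big_seq_fset1 cmUU expr1. Qed.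
End Evaluation.

Lemma poly_eval_mmap (h : E -> P) (p : P) :
  poly_eval h p = mmap (malgC : K -> {malg K[{cmonom E}]}) (monom_eval h) p.
Proof. by []. Qed.

Lemma poly_eval_morphism (h : E -> P) : alg_morphism (poly_eval h).
Proof.
split=> [c|p q|p q]; rewrite !poly_eval_mmap.
- by rewrite mmapC.
- by rewrite mmapD.
- by rewrite rmorphM.
Qed.

Lemma poly_eval_var (h : E -> P) e : poly_eval h (poly_var K e) = h e.
Proof. by rewrite poly_eval_mmap mmapU monom_evalU mul1r. Qed.

Lemma alg_morphism_poly_eval (f : P -> P) (h : E -> P) (p : P) :
  alg_morphism f -> f (poly_eval h p) = poly_eval (f \o h) p.
Proof.
case=> fC fD fM; have f0 : f 0 = 0 by apply: (addrI (f 0)); rewrite -fD !addr0.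
have f1 : f 1 = 1 by exact: (fC 1).
rewrite (big_morph f fD f0); apply: eq_bigr => m _; rewrite fM fC.
congr (_ * _); rewrite (big_morph f fM f1); apply: eq_bigr => e _ /=.
by elim: (m e) => [|n IH]; rewrite ?expr0 // !exprS fM IH.
Qed.

Lemma poly_eval_id (p : P) : poly_eval (@poly_var K E) p = p.
Proof.
rewrite [RHS]monalgE; apply: eq_bigr => m _.
suff -> : \prod_(e <- finsupp m) poly_var K e ^+ m e = << m >> :> P.
  by rewrite /scal /= malgM_def fgmulUU mulr1 mul1m.
have UX e n : poly_var K e ^+ n = << iterop n mmul (ucm e) mone >> :> P.
  elim: n => [//|n IH]; rewrite exprS IH /poly_var malgM_def fgmulUU mulr1.
  by congr << _ >>; case: n {IH} => //=; rewrite mulm1.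
under eq_bigr do rewrite UX.
have UM (m1 m2 : {cmonom E}) : << mmul m1 m2 >> = << m1 >> * << m2 >> :> P.
  by rewrite malgM_def fgmulUU mulr1.
rewrite -(big_morph (fun m : {cmonom E} => << m >> : P) UM (erefl 1)).
congr << _ >>; apply/eqP/cmP => e.
have iterE (f : E) n : iterop n mmul (ucm f) mone e = (n * (f == e))%N.
  by elim: n => [|[|n] IH]; rewrite ?cm1 ?mul0n ?cmU ?mul1n // [iterop _ _ _ _]/= cmM cmU; move: IH => /= ->.
rewrite (big_morph (fun m : {cmonom E} => m e) (cmM e) (cm1 e)).
under eq_bigr do rewrite iterE.
case: (mdomP m e) => em.
  rewrite (big_fsetD1 e) //= eqxx muln1 big1_fset ?addn0 // => f.
  by rewrite in_fsetD1 => /andP[/negbTE -> _]; rewrite muln0.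
rewrite big1_fset // => f fm _; case: eqP => [fe|_]; last by rewrite muln0.
by rewrite -fe fm in em.
Qed.
End PolynomialMorphisms.

Section TGW.
Variables (K : comNzRingType) (R : pzAlgType K) (I : choiceType).

Record tgw_datum := TgwDatum {
  tgw_sigma : I -> R -> R;
  tgw_sigmaV : I -> R -> R;
  tgw_t : I -> R;
  tgw_sigma_morphism : forall i, alg_morphism (tgw_sigma i);
  tgw_sigmaK : forall i, cancel (tgw_sigma i) (tgw_sigmaV i);
  tgw_sigmaVK : forall i, cancel (tgw_sigmaV i) (tgw_sigma i);
  tgw_sigmaC : forall i j r,
    tgw_sigma i (tgw_sigma j r) = tgw_sigma j (tgw_sigma i r);
  tgw_t_neq0 : forall i, tgw_t i != 0;
  tgw_t_central : forall i r, tgw_t i * r = r * tgw_t i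
}.

Variables (D : tgw_datum) (mu : I -> I -> K).

Definition tgw_free : pzAlgType K := free_alg K (R + I + I)%type.

Definition rgen (r : R) : tgw_free := free_gen K (inl (inl r)).
Definition Xgen (i : I) : tgw_free := free_gen K (inl (inr i)).
Definition Ygen (i : I) : tgw_free := free_gen K (inr i).

(* The first three families of relations make the free algebra on R, X, Y the
   free R-ring on X, Y. *)
Inductive tgw_rel : tgw_free -> tgw_free -> Prop :=
  | rel_scal c : tgw_rel (rgen (scal c)) (scal c)
  | rel_add r s : tgw_rel (rgen (r + s)) (rgen r + rgen s)
  | rel_mul r s : tgw_rel (rgen (r * s)) (rgen r * rgen s)
  | rel_Xr i r : tgw_rel (Xgen i * rgen r) (rgen (tgw_sigma D i r) * Xgen i)
  | rel_Yr i r : tgw_rel (Ygen i * rgen r) (rgen (tgw_sigmaV D i r) * Ygen i)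
  | rel_YX i : tgw_rel (Ygen i * Xgen i) (rgen (tgw_t D i))
  | rel_XY i : tgw_rel (Xgen i * Ygen i) (rgen (tgw_sigma D i (tgw_t D i)))
  | rel_XYC i j : i != j ->
      tgw_rel (Xgen i * Ygen j) (scal (mu i j) * (Ygen j * Xgen i)).

Definition tgw_C : pzAlgType K := presented_alg tgw_rel.

Definition gen_deg (g : (R + I + I)%type) : {malg I} :=
  match g with
  | inl (inl _) => 0
  | inl (inr i) => << i >>
  | inr i => - << i >>
  end.

Definition word_deg (w : {fmonom (R + I + I)%type}) : {malg I} :=
  \sum_(g <- (w : seq _)) gen_deg g.

Definition tgw_C_homog (d : {malg I}) : set tgw_C :=
  [set c | exists2 f : free_alg K (R + I + I)%type,
     (forall w, w \in msupp f -> word_deg w = d) & c = quot_pi _ f].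

Definition graded_ideal (J : ideal tgw_C) : Prop :=
  forall x, J x -> exists2 s : seq tgw_C,
    (forall y, y \in s -> J y /\ exists d, tgw_C_homog d y)
    & x = \sum_(y <- s) y.

Definition tgw_radical : ideal tgw_C :=
  ideal_sum [set J | graded_ideal J /\
                     forall x, J x -> tgw_C_homog 0 x -> x = 0].

Definition tgw : pzAlgType K := quot_alg tgw_radical.

Definition tgw_of_free (f : tgw_free) : tgw := quot_pi _ (quot_pi _ f).
Definition tgw_r (r : R) : tgw := tgw_of_free (rgen r).
Definition tgw_X (i : I) : tgw := tgw_of_free (Xgen i).
Definition tgw_Y (i : I) : tgw := tgw_of_free (Ygen i).
End TGW.

#[local] Obligation Tactic := idtac.

Section Multiquivers.
Variables (V E : choiceType).

Definition has_vertex (x : option (V * nat)) (v : V) : bool := omap fst x == Some v.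
Definition multiplicity (x : option (V * nat)) : nat := oapp snd 0%N x.

Record multiquiver := Multiquiver {
  src : E -> option (V * nat);
  tgt : E -> option (V * nat);
  src_gt0 : forall e v n, src e = Some (v, n) -> (0 < n)%N;
  tgt_gt0 : forall e v n, tgt e = Some (v, n) -> (0 < n)%N;
  no_loops : forall e u m v n, src e = Some (u, m) -> tgt e = Some (v, n) -> u != v;
  locally_finite : forall v,
    finite_set [set e | has_vertex (src e) v || has_vertex (tgt e) v]
}.

Variable Gam : multiquiver.

Definition incident (v : V) (e : E) : bool :=
  has_vertex (src Gam e) v || has_vertex (tgt Gam e) v.

Definition leaf (e : E) : bool := (src Gam e == None) || (tgt Gam e == None).

Definition edges_at (v : V) : {fset E} := fset_set [set e | incident v e].

Definition gamma_coef (e : E) (v : V) : int :=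
  if has_vertex (tgt Gam e) v then (multiplicity (tgt Gam e))%:Z
  else if has_vertex (src Gam e) v then - (multiplicity (src Gam e))%:Z
  else 0.

Definition gamma (a : {malg V}) : {malg E} :=
  \sum_(v <- msupp a) \sum_(e <- edges_at v) << a@_v * gamma_coef e v *g e >>.

(* Components are taken in the bipartite incidence graph on V + E, so that an
   edge with neither source nor target is a component by itself. *)
Definition linked : V + E -> V + E -> Prop :=
  clos_refl_sym_trans (V + E)
    (fun x y => if (x, y) is (inl v, inr e) then incident v e else False).
End Multiquivers.

Section Subgraphs.
Variables (V E : choiceType) (Gam : multiquiver V E) (V' : set V) (E' : set E).

Definition restrict_end (x : option (V * nat)) : option (V' * nat) :=
  if x is Some (v, n) then omap (fun v' : V' => (v', n)) (insub v) else None.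

Lemma restrict_endP x v' n :
  restrict_end x = Some (v', n) -> x = Some (val v', n).
Proof.
by case: x => [[v k]|] //=; case: insubP => //= w _ <- [-> ->].
Qed.

Fact subgraph_finite (v : V') :
  finite_set [set e : E' | has_vertex (restrict_end (src Gam (val e))) v
                        || has_vertex (restrict_end (tgt Gam (val e))) v].
Proof.
have := finite_preimage (B := _) (f := val : E' -> E) _ (locally_finite Gam (val v)).
move=> /(_ (in2W val_inj)); apply: sub_finite_set => e /=.
have H x : has_vertex (restrict_end x) v -> has_vertex x (val v).
  rewrite /has_vertex; case Ex: (restrict_end x) => [[w n]|] //= /eqP[wv].
  by rewrite (restrict_endP Ex) wv.
by case/orP => /H ->; rewrite ?orbT.
Qed.

Program Definition subgraph : multiquiver V' E' :=
  @Multiquiver V' E' (fun e => restrict_end (src Gam (val e)))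
    (fun e => restrict_end (tgt Gam (val e))) _ _ _ subgraph_finite.
Next Obligation. by move=> e v n /restrict_endP; exact: src_gt0. Qed.
Next Obligation. by move=> e v n /restrict_endP; exact: tgt_gt0. Qed.
Next Obligation.
move=> e u m v n /restrict_endP Hs /restrict_endP Ht.
by have := no_loops Hs Ht; apply: contra_neq => ->.
Qed.
End Subgraphs.

Section ReverseEdges.
Variables (V E : choiceType) (Gam : multiquiver V E) (r : pred E).

Let rsrc e := if r e then tgt Gam e else src Gam e.
Let rtgt e := if r e then src Gam e else tgt Gam e.

Program Definition reverse_edges : multiquiver V E :=
  @Multiquiver V E rsrc rtgt _ _ _ _.
Next Obligation.
by move=> e v n; rewrite /rsrc; case: ifP => _; [exact: tgt_gt0|exact: src_gt0].
Qed.
Next Obligation.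
by move=> e v n; rewrite /rtgt; case: ifP => _; [exact: src_gt0|exact: tgt_gt0].
Qed.
Next Obligation.
move=> e u m v n; rewrite /rsrc /rtgt; case: ifP => _ H1 H2; last exact: no_loops H1 H2.
by rewrite eq_sym; exact: no_loops H2 H1.
Qed.
Next Obligation.
move=> v; have := locally_finite Gam v; apply: sub_finite_set => e /=.
by rewrite /rsrc /rtgt; case: ifP => // _; rewrite orbC.
Qed.
End ReverseEdges.

Definition mq_iso (V E V' E' : choiceType)
    (Gam : multiquiver V E) (Gam' : multiquiver V' E') : Prop :=
  exists (f : V -> V') (g : E -> E'), [/\ bijective f, bijective g,
    forall e, src Gam' (g e) = omap (fun vn => (f vn.1, vn.2)) (src Gam e)
    & forall e, tgt Gam' (g e) = omap (fun vn => (f vn.1, vn.2)) (tgt Gam e)].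

Definition sign_equivalent (V E V' E' : choiceType)
    (Gam : multiquiver V E) (Gam' : multiquiver V' E') : Prop :=
  exists r : pred E, mq_iso (reverse_edges Gam r) Gam'.

Definition cycle_labelling (V E : choiceType) (Gam : multiquiver V E) (n : nat)
    (v : 'I_n -> V) (e : 'I_n -> E) (out inn : 'I_n -> nat) : Prop :=
  [/\ (0 < n)%N, bijective v, bijective e,
      forall i, src Gam (e i) = Some (v i, out i)
    & forall i, tgt Gam (e i) = Some (v (ordS i), inn i)].

Definition directed_cycle (V E : choiceType) (Gam : multiquiver V E) : Prop :=
  exists n v e out inn, @cycle_labelling V E Gam n v e out inn.

Definition balanced_directed_cycle (V E : choiceType) (Gam : multiquiver V E) : Prop :=
  exists n v e out inn, @cycle_labelling V E Gam n v e out inn /\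
    (\prod_i out i = \prod_i inn i)%N.

Definition nnd_cycle (V E : choiceType) (Gam : multiquiver V E) : Prop :=
  exists (V' E' : choiceType) (Gam' : multiquiver V' E'),
    directed_cycle Gam' /\ sign_equivalent Gam Gam'.

Definition balanced_nnd_cycle (V E : choiceType) (Gam : multiquiver V E) : Prop :=
  exists (V' E' : choiceType) (Gam' : multiquiver V' E'),
    balanced_directed_cycle Gam' /\ sign_equivalent Gam Gam'.

Definition component (V E : choiceType) (Gam : multiquiver V E) (x : V + E) :=
  subgraph Gam [set v | linked Gam x (inl v)] [set e | linked Gam x (inr e)].

Definition in_equilibrium (V E : choiceType) (Gam : multiquiver V E) : Prop :=
  [/\ finite_set [set: V], forall e, ~~ leaf Gam e
    & forall (V' : set V) (E' : set E),
        nnd_cycle (subgraph Gam V' E') -> balanced_nnd_cycle (subgraph Gam V' E')].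

Section WeylAlgebra.
Variables (K : comNzRingType) (E : choiceType).

Definition weyl_free : pzAlgType K := free_alg K (E + E)%type.

Local Notation xgen e := (free_gen K (inl e : E + E) : weyl_free).
Local Notation ygen e := (free_gen K (inr e : E + E) : weyl_free).

Inductive weyl_rel : weyl_free -> weyl_free -> Prop :=
  | weyl_xx e f : weyl_rel (xgen e * xgen f - xgen f * xgen e) 0
  | weyl_yy e f : weyl_rel (ygen e * ygen f - ygen f * ygen e) 0
  | weyl_yx e f : weyl_rel (ygen e * xgen f - xgen f * ygen e) (e == f)%:R.

Definition weyl : pzAlgType K := presented_alg weyl_rel.

Definition weyl_x (e : E) : weyl := quot_pi _ (xgen e).
Definition weyl_y (e : E) : weyl := quot_pi _ (ygen e).

Definition weyl_zpow (e : E) (p : int) : weyl :=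
  if 0 <= p then weyl_x e ^+ `|p|%N else weyl_y e ^+ `|p|%N.

(* The factors commute, so the enumeration order of the support is irrelevant. *)
Definition weyl_z (k : {malg E}) : weyl := \prod_(e <- msupp k) weyl_zpow e k@_e.
End WeylAlgebra.

Section MultiquiverAlgebra.
Variables (K : fieldType) (charK : [pchar K] =i pred0).
Variables (V E : choiceType) (Gam : multiquiver V E).

Local Notation R_E := (poly_alg K E).
Local Notation u := (@poly_var K E).

Definition mq_sigma (v : V) : R_E -> R_E :=
  poly_eval (fun e => u e - (gamma_coef Gam e v)%:~R : R_E).

Definition mq_sigmaV (v : V) : R_E -> R_E :=
  poly_eval (fun e => u e + (gamma_coef Gam e v)%:~R : R_E).

Definition mq_u (e : E) (v : V) : R_E :=
  match gamma_coef Gam e v with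
  | Posz n => \prod_(0 <= i < n) (u e + i%:R)
  | Negz n => \prod_(1 <= i < n.+2) (u e - i%:R)
  end.

(* [mq_u e v = 1] for an edge not incident to v. *)
Definition mq_t (v : V) : R_E := \prod_(e <- edges_at Gam v) mq_u e v.

Fact mq_sigma_morphism v : alg_morphism (mq_sigma v).
Proof. exact: poly_eval_morphism. Qed.

Let poly_eval_comp (h h' : E -> R_E) (p : R_E) :
  (forall e, poly_eval h (h' e) = u e) -> poly_eval h (poly_eval h' p) = p.
Proof.
move=> hh'; rewrite (alg_morphism_poly_eval _ _ (poly_eval_morphism h)).
by rewrite (funext hh' : _ \o _ = u) poly_eval_id.
Qed.

Let poly_eval_shift (h : E -> R_E) e (z : int) :
  poly_eval h (u e + z%:~R) = h e + z%:~R.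
Proof. by rewrite !poly_eval_mmap rmorphD /= rmorph_int -poly_eval_mmap poly_eval_var. Qed.

Fact mq_sigmaK v : cancel (mq_sigma v) (mq_sigmaV v).
Proof. by move=> p; apply: poly_eval_comp => e; rewrite -rmorphN poly_eval_shift rmorphN addrK. Qed.

Fact mq_sigmaVK v : cancel (mq_sigmaV v) (mq_sigma v).
Proof. by move=> p; apply: poly_eval_comp => e; rewrite poly_eval_shift subrK. Qed.

Fact mq_sigmaC v w p : mq_sigma v (mq_sigma w p) = mq_sigma w (mq_sigma v p).
Proof.
pose s w e : R_E := u e - (gamma_coef Gam e w)%:~R.
suff sC : poly_eval (s v) \o s w = poly_eval (s w) \o s v.
  rewrite /mq_sigma -/(s v) -/(s w) (alg_morphism_poly_eval _ _ (poly_eval_morphism (s v))).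
  by rewrite sC -(alg_morphism_poly_eval _ _ (poly_eval_morphism (s w))).
apply: funext => e; rewrite /= /s -!rmorphN !poly_eval_shift !rmorphN; exact: addrAC.
Qed.

Fact mq_t_neq0 v : mq_t v != 0.
Proof.
have nat_neq0 n : (n.+1%:R : K) != 0 by rewrite ((pcharf0P K).1 charK).
pose ev : R_E -> K :=
  mmap idfun (monom_eval (fun e => if 0 <= gamma_coef Gam e v then 1 else 0 : K)).
suff: ev (mq_t v) != 0 by apply: contra_neq => ->; exact: rmorph0.
rewrite /ev rmorph_prod prodf_seq_neq0; apply/allP => e _ /=; rewrite /mq_u.
have evu : ev (u e) = if 0 <= gamma_coef Gam e v then 1 else 0.
  by rewrite /ev mmapU /= mul1r monom_evalU.
case Eg : (gamma_coef Gam e v) evu => [n|n] /= evu;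
    rewrite rmorph_prod prodf_seq_neq0; apply/allP => i /=.
  by rewrite rmorphD rmorph_nat [X in X + _]evu addrC natr1.
rewrite mem_index_iota => /andP[i_gt0 _].
by rewrite rmorphB rmorph_nat [X in X - _]evu sub0r oppr_eq0 -(prednK i_gt0).
Qed.

Definition mq_datum : tgw_datum R_E V :=
  TgwDatum mq_sigma_morphism mq_sigmaK mq_sigmaVK mq_sigmaC mq_t_neq0
    (fun v r => mulrC (mq_t v) r).

Definition mq_tgw : pzAlgType K := tgw mq_datum (fun _ _ => 1).

Definition mq_R : set mq_tgw := range (@tgw_r K R_E V mq_datum (fun _ _ => 1)).

Definition canonical_gen (g : R_E + V + V) : weyl K E :=
  match g with
  | inl (inl r) => poly_eval (fun e => weyl_y K e * weyl_x K e) r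
  | inl (inr v) => weyl_z K (gamma Gam << v >>)
  | inr v => weyl_z K (- gamma Gam << v >>)
  end.

(* The algebra morphism induced on the quotient by [canonical_gen], written as
   the evaluation of a representative: the evaluation vanishes on the relations
   [tgw_rel] and on representatives of elements of [tgw_radical]. *)
Definition canonical_rep (a : mq_tgw) : weyl K E :=
  free_eval canonical_gen (quot_repr (quot_repr a)).
End MultiquiverAlgebra.

Arguments mq_tgw {K} charK {V E} Gam.
Arguments mq_R {K} charK {V E} Gam _.
Arguments canonical_rep {K} charK {V E} Gam a.

(* Main.v *)
Require Import Defs.
From HB Require Import structures.
From Stdlib Require Import Relation_Operators.
From mathcomp Require Import all_boot all_order all_algebra.
From mathcomp Require Import finmap zify ring.
From mathcomp Require Import boolp classical_sets cardinality.
From mathcomp.multinomials Require Import monalg.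

(* Let R = K[u_e] and let ZE act on R by shifts of the u_e.
   The Weyl algebra embeds into the skew group ring R # ZE by x_e |-> T^e and
   y_e |-> u_e T^(-e), because it is spanned over R by the z^k, and z^k is sent to
   c_k T^k for a regular element c_k of R. Letting ZV act on R through gamma, the
   assignment X_v |-> c_(gamma v) T^v, Y_v |-> c_(- gamma v) T^(-v) identifies
   A(Gamma) with a subring of R # ZV: the radical of C is the kernel, since a
   homogeneous element of an ideal meeting the degree zero part trivially dies
   after multiplication by a word of opposite degree, and conversely the degree
   zero part of C is R. In these terms phi_Gamma is the map R # ZV -> R # ZE
   induced by gamma, and the centralizer of R consists of the terms r T^a with
   gamma a = 0; this gives the equivalence of (i), (ii) and (iii).

   A vector a lies in the kernel of gamma iff m a_u = n a_v for every edge with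
   ends (u, m) and (v, n), a missing end contributing 0. Hence a nonzero kernel
   vector vanishes nowhere on some component, which is then finite, leafless, and
   has balanced cycles by multiplying these relations around a cycle. Conversely,
   in a component in equilibrium the product of the ratios m / n along a closed
   walk is 1 (split at a repeated vertex until the walk is a cycle), so products
   along walks from a base vertex define a rational kernel vector. *)

Set Implicit Arguments.
Unset Strict Implicit.
Unset Printing Implicit Defensive.

Import GRing.Theory Order.TTheory Num.Theory.
Local Open Scope ring_scope.

(** * Skew group rings *)

Section LinearExtension.
Variables (I : choiceType) (G M : zmodType).

(** The skew product, the coefficient maps, the pushforward and [gamma] are all of this form, so one
    proof of additivity serves them all. *)
Definition malg_lift (h : I -> {additive G -> M}) (g : {malg G[I]}) : M :=
  \sum_(k <- msupp g) h k g@_k.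

Lemma malg_liftEw h (d : {fset I}) g : (msupp g `<=` d)%fset ->
  malg_lift h g = \sum_(k <- d) h k g@_k.
Proof.
move=> le; rewrite /malg_lift (big_fset_incl _ le) // => k _ /mcoeff_outdom ->.
by rewrite raddf0.
Qed.

Fact malg_lift_is_additive h : {morph malg_lift h : x y / x - y}.
Proof.
move=> x y; rewrite (malg_liftEw h (msuppB_le x y)).
rewrite (malg_liftEw h (fsubsetUl (msupp x) (msupp y))).
rewrite (malg_liftEw h (fsubsetUr (msupp x) (msupp y))) -sumrB.
by apply: eq_bigr => k _; rewrite mcoeffB raddfB.
Qed.

HB.instance Definition _ h :=
  GRing.isZmodMorphism.Build {malg G[I]} M (malg_lift h) (malg_lift_is_additive h).

Lemma malg_lift0 h : malg_lift h 0 = 0.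
Proof. exact: raddf0. Qed.

Lemma malg_liftD h : {morph malg_lift h : x y / x + y}.
Proof. exact: raddfD. Qed.

Lemma malg_liftU h c k : malg_lift h << c *g k >> = h k c.
Proof. by rewrite (malg_liftEw _ msuppU_le) big_seq_fset1 mcoeffUU. Qed.

Lemma malg_ind (P : {malg G[I]} -> Prop) :
  P 0 -> (forall x y, P x -> P y -> P (x + y)) ->
  (forall c k, P << c *g k >>) -> forall g, P g.
Proof. by move=> P0 PD PU g; rewrite (monalgE g); apply: big_ind. Qed.

End LinearExtension.

Lemma mcoeff_sumU (I : choiceType) (G : zmodType) (d : {fset I}) (F : I -> G) k :
  k \in d -> (\sum_(l <- d) << F l *g l >>)@_k = F k.
Proof.
move=> kd; rewrite raddf_sum /= (big_fsetD1 k kd) /= mcoeffUU big1_fset ?addr0 // => l.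
by rewrite in_fsetD1 => /andP[lk _] _; rewrite mcoeffU (negbTE lk).
Qed.

Lemma malgU_inj (I : choiceType) (G : zmodType) (r s : G) (a b : I) :
  r != 0 -> << r *g a >> = << s *g b >> -> a = b.
Proof.
move=> r0 /(congr1 (mcoeff a)); rewrite mcoeffUU mcoeffU; case: eqP => [-> //|_ rE].
by rewrite rE eqxx in r0.
Qed.

Lemma malg_liftM (I : monomType) (G : nzRingType) (M : pzRingType)
    (h : I -> {additive G -> M}) :
  (forall i j c d, h (mmul i j) (c * d) = h i c * h j d) ->
  {morph malg_lift h : x y / x * y}.
Proof.
move=> hM x y; elim/malg_ind: x => [|x z IHx IHz|c m].
- by rewrite mul0r !malg_lift0 mul0r.
- rewrite mulrDl (malg_liftD h x) mulrDl -IHx -IHz; exact: malg_liftD.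
elim/malg_ind: y => [|x z IHx IHz|d n]; first by rewrite mulr0 !malg_lift0 mulr0.
  rewrite mulrDr (malg_liftD h x) mulrDr -IHx -IHz; exact: malg_liftD.
by rewrite malgM_def fgmulUU !malg_liftU.
Qed.

Section PzAlgTheory.
Variables (K : comPzRingType) (A : pzAlgType K).

Lemma scal_is_zmod_morphism : {morph (scal : K -> A) : x y / x - y}.
Proof. by move=> x y; apply: (addIr (scal y)); rewrite -scalD !subrK. Qed.

HB.instance Definition _ := GRing.isZmodMorphism.Build K A scal scal_is_zmod_morphism.
Lemma scal_is_monoid_morphism : monoid_morphism (scal : K -> A).
Proof. by split; [exact: scal1|exact: scalM]. Qed.

HB.instance Definition _ := GRing.isMonoidMorphism.Build K A scal scal_is_monoid_morphism.
End PzAlgTheory.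

Lemma free_monomE (K : comNzRingType) (Gen : choiceType) (c : K) (w : {fmonom Gen}) :
  << c *g w >> = scal c * \prod_(g <- (w : seq Gen)) free_gen K g :> free_alg K Gen.
Proof.
case: w => s /=; have -> : \prod_(g <- s) free_gen K g = << FMonom s >> :> free_alg K Gen.
  elim: s => [|g s IH]; first by rewrite big_nil -fmoneE.
  by rewrite big_cons IH /free_gen malgM_def fgmulUU mulr1 /mmul /= fmmulE fmU.
by rewrite /scal /= malgM_def fgmulUU mulr1 mul1m.
Qed.

Lemma quot_pi0 (K : comPzRingType) (A : pzAlgType K) (J : ideal A) : quot_pi J 0 = 0.
Proof. by apply: (addrI (quot_pi J 0)); rewrite -quot_piD !addr0. Qed.

(** * Polynomial algebras: the action by shifts, and regular elements *)

Section Polynomials.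
Variables (K : comNzRingType) (E : choiceType).
Local Notation R := (poly_alg K E).
Local Notation u := (@poly_var K E).

Lemma poly_alg_ind (P : R -> Prop) : (forall c, P (scal c)) -> (forall e, P (u e)) ->
  (forall x y, P x -> P y -> P (x + y)) -> (forall x y, P x -> P y -> P (x * y)) ->
  forall p, P p.
Proof.
move=> PC PU PD PM p; rewrite -(poly_eval_id p).
have P0 : P 0 by rewrite -(raddf0 (@scal K R)); exact: PC.
have P1 : P 1 by rewrite -(scal1 (s := R)); exact: PC.
rewrite /poly_eval; apply: (big_ind P P0 PD) => m _; apply: (PM _ _); first exact: PC.
apply: (big_ind P P1 PM) => e _; elim: (m e) => [|n IH]; first by rewrite expr0.
by rewrite exprS; exact: (PM _ _ (PU e) IH).
Qed.

(** The sign is that of $x_e u_e = (u_e - 1) x_e$ in the Weyl algebra, where $u_e = y_e x_e$. *)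
Definition shift_var (k : {malg E}) e : R := u e - (k@_e)%:~R.

(* Opaque, since the conversion test would otherwise unfold polynomial
   evaluations. *)
Fact shift_sig : {s : {malg E} -> R -> R | forall k, s k = poly_eval (shift_var k)}.
Proof. by exists (fun k => poly_eval (shift_var k)). Qed.

Definition shift : {malg E} -> R -> R := sval shift_sig.

Lemma shiftE k : shift k = poly_eval (shift_var k).
Proof. exact: svalP shift_sig k. Qed.

Lemma shiftC k c : shift k (scal c) = scal c.
Proof. by rewrite shiftE; case: (poly_eval_morphism (shift_var k)). Qed.

Lemma shift_add k : {morph shift k : x y / x + y}.
Proof. by rewrite shiftE; case: (poly_eval_morphism (shift_var k)). Qed.

Lemma shift_mul k : {morph shift k : x y / x * y}.
Proof. by rewrite shiftE; case: (poly_eval_morphism (shift_var k)). Qed.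

Fact shift_is_zmod_morphism k : {morph shift k : x y / x - y}.
Proof. by move=> x y; apply: (addIr (shift k y)); rewrite -shift_add !subrK. Qed.

Fact shift_is_monoid_morphism k : monoid_morphism (shift k).
Proof. by split; [exact: (shiftC k 1)|exact: shift_mul]. Qed.

HB.instance Definition _ k :=
  GRing.isZmodMorphism.Build R R (shift k) (shift_is_zmod_morphism k).
HB.instance Definition _ k :=
  GRing.isMonoidMorphism.Build R R (shift k) (shift_is_monoid_morphism k).

Lemma shift_u k e : shift k (u e) = u e - (k@_e)%:~R.
Proof. by rewrite shiftE poly_eval_var. Qed.

Lemma shift0 p : shift 0 p = p.
Proof.
elim/poly_alg_ind: p => [c|e|x y IHx IHy|x y IHx IHy]; first by rewrite !shiftC.
- by rewrite shift_u mcoeff0 subr0.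
- by rewrite rmorphD /= IHx IHy.
- by rewrite rmorphM /= IHx IHy.
Qed.

Lemma shiftD k l p : shift (k + l) p = shift k (shift l p).
Proof.
elim/poly_alg_ind: p => [c|e|x y IHx IHy|x y IHx IHy]; first by rewrite !shiftC.
- by rewrite !shift_u rmorphB /= rmorph_int shift_u mcoeffD rmorphD opprD addrA.
- by rewrite !rmorphD /= IHx IHy.
- by rewrite !rmorphM /= IHx IHy.
Qed.

Lemma shiftK k : cancel (shift k) (shift (- k)).
Proof. by move=> p; rewrite -shiftD addNr shift0. Qed.

Lemma shift_eq0 k p : shift k p = 0 -> p = 0.
Proof. by move=> /(congr1 (shift (- k))); rewrite shiftK rmorph0. Qed.

(** Here [K] is only a commutative ring, so a nonzero polynomial may be a zero divisor and
    cancellability is recorded explicitly. *)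
Definition regular (r : R) := forall p, r * p = 0 -> p = 0.

Lemma regular1 : regular 1. Proof. by move=> p; rewrite mul1r. Qed.

Lemma regularM r s : regular r -> regular s -> regular (r * s).
Proof. by move=> rr rs p; rewrite -mulrA => /rr /rs. Qed.

Lemma regular_shift k r : regular r -> regular (shift k r).
Proof.
move=> rr p /(congr1 (shift (- k))); rewrite rmorphM /= shiftK rmorph0.
by move/rr/shift_eq0.
Qed.

(** Multiplication by [u e] moves the coefficient at a monomial $m$ to $u_e m$, and $m \mapsto u_e
    m$ is injective on monomials. *)
Lemma regular_var e : regular (u e).
Proof.
move=> p up0; apply/malgP => m; rewrite mcoeff0.
have := congr1 (mcoeff (mmul (ucm e) m)) up0; rewrite mcoeff0 => <-.
rewrite malgM_def fgmulUg raddf_sum /= [in LHS](monalgE p) raddf_sum /=.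
apply: eq_bigr => l _; rewrite !mcoeffU mul1r; congr (_ *+ nat_of_bool _).
apply/eqP/eqP => [->//|/eqP/cmP h]; apply/eqP/cmP => i.
by have := h i; rewrite !cmM => /addnI.
Qed.

(** The element is the image of [u e] under a shift, which is an automorphism. *)
Lemma regular_var_addz e (z : int) : regular (u e + z%:~R).
Proof.
have -> : u e + z%:~R = shift << - z *g e >> (u e).
  by rewrite shift_u mcoeffUU rmorphN opprK.
exact/regular_shift/regular_var.
Qed.

Lemma regular_prod (I : Type) (s : seq I) (P : pred I) (F : I -> R) :
  (forall i, P i -> regular (F i)) -> regular (\prod_(i <- s | P i) F i).
Proof. exact: (big_ind regular regular1 regularM). Qed.

Lemma regular_neq0 r : regular r -> r != 0.
Proof.
move=> rr; apply/eqP => r0; have := rr 1; rewrite r0 mul0r => /(_ erefl)/eqP.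
by rewrite oner_eq0.
Qed.

End Polynomials.

(** * The skew product, and evaluation of a free algebra in a skew group ring *)

Section TwistedCoefficients.
Variables (K : comNzRingType) (R : pzAlgType K) (G : zmodType).
Variable sig : G -> R -> R.
Hypotheses (sig_morph : forall k, alg_morphism (sig k))
  (sig0 : forall r, sig 0 r = r)
  (sigD : forall k l r, sig (k + l) r = sig k (sig l r)).
Local Notation S := {malg R[G]}.

Let sig_add k : {morph sig k : x y / x + y}. Proof. by case: (sig_morph k). Qed.
Let sig_mul k : {morph sig k : x y / x * y}. Proof. by case: (sig_morph k). Qed.
Let sig_scal k c : sig k (scal c) = scal c. Proof. by case: (sig_morph k). Qed.
Let sig_zero k : sig k 0 = 0.
Proof. by apply: (addrI (sig k 0)); rewrite -sig_add !addr0. Qed.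
Let sig_sub k : {morph sig k : x y / x - y}.
Proof. by move=> x y; apply: (addIr (sig k y)); rewrite -sig_add !subrK. Qed.

Lemma sig_inj0 k p : sig k p = 0 -> p = 0.
Proof. by move=> p0; rewrite -(sig0 p) -(addNr k) sigD p0 sig_zero. Qed.

(** With [<< r *g k >>] read as $r T^k$, this is $r T^k \cdot s T^l$ computed by the rule $T^k s =
    \sigma_k(s) T^k$. *)
Definition skew_mulU (k : G) (r : R) (l : G) (s : R) : S :=
  << r * sig k s *g k + l >>.

Fact skew_mulU_additive k r l : {morph skew_mulU k r l : x y / x - y}.
Proof. by move=> x y; rewrite /skew_mulU sig_sub mulrBr monalgUB. Qed.

HB.instance Definition _ k r l :=
  GRing.isZmodMorphism.Build R S (skew_mulU k r l) (skew_mulU_additive k r l).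

Definition skew_mull (k : G) (y : S) (r : R) : S := malg_lift (skew_mulU k r) y.

Lemma skew_mullU k r l s :
  skew_mull k << s *g l >> r = << r * sig k s *g k + l >>.
Proof. by rewrite /skew_mull malg_liftU. Qed.

Lemma skew_mull0 k r : skew_mull k 0 r = 0.
Proof. exact: malg_lift0. Qed.

Lemma skew_mullD k r x y : skew_mull k (x + y) r = skew_mull k x r + skew_mull k y r.
Proof. exact: malg_liftD. Qed.

Fact skew_mull_additive k y : {morph skew_mull k y : x y / x - y}.
Proof.
move=> r s; elim/malg_ind: y => [|x y IHx IHy|c l]; first by rewrite !skew_mull0 subr0.
  by rewrite !skew_mullD IHx IHy /= opprD addrACA.
by rewrite !skew_mullU mulrBl monalgUB.
Qed.

HB.instance Definition _ k y :=
  GRing.isZmodMorphism.Build R S (skew_mull k y) (skew_mull_additive k y).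

Fact skew_mul_sig : {m : S -> S -> S | forall x y,
  m x y = malg_lift (fun k => skew_mull k y : {additive R -> S}) x}.
Proof.
by exists (fun x y => malg_lift (fun k => skew_mull k y : {additive R -> S}) x).
Qed.

(* Product of the skew group ring [R # G], in which [G] acts on [R] through [sig]. *)
Definition skew_mul : S -> S -> S := sval skew_mul_sig.

Lemma skew_mulE x y :
  skew_mul x y = malg_lift (fun k => skew_mull k y : {additive R -> S}) x.
Proof. exact: svalP skew_mul_sig x y. Qed.

Lemma skew_mulUl k r y : skew_mul << r *g k >> y = skew_mull k y r.
Proof. by rewrite skew_mulE malg_liftU. Qed.

Lemma skew_mulUU k r l s :
  skew_mul << r *g k >> << s *g l >> = << r * sig k s *g k + l >>.
Proof. by rewrite skew_mulUl skew_mullU. Qed.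

Lemma skew_mul0l y : skew_mul 0 y = 0.
Proof. by rewrite skew_mulE malg_lift0. Qed.

Lemma skew_mulDl x y z : skew_mul (x + y) z = skew_mul x z + skew_mul y z.
Proof. by rewrite !skew_mulE malg_liftD. Qed.

Lemma skew_mul0r x : skew_mul x 0 = 0.
Proof. by rewrite !skew_mulE /malg_lift big1 // => k _; exact: skew_mull0. Qed.

Lemma skew_mulDr x y z : skew_mul x (y + z) = skew_mul x y + skew_mul x z.
Proof.
by rewrite !skew_mulE /malg_lift -big_split; apply: eq_bigr => k _; exact: skew_mullD.
Qed.

Lemma skew_mulUl_coef k r y a :
  (skew_mul << r *g k >> y)@_(k + a) = r * sig k y@_a.
Proof.
rewrite skew_mulUl; elim/malg_ind: y => [|x y IHx IHy|c l].
- by rewrite skew_mull0 !mcoeff0 sig_zero mulr0.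
- by rewrite skew_mullD !mcoeffD IHx IHy sig_add mulrDr.
rewrite skew_mullU !mcoeffU (inj_eq (addrI k)).
by case: eqP => _; rewrite ?mulr1n // !mulr0n sig_zero mulr0.
Qed.

(** Together with the case [k = 0] of [skew_mulUl_coef], this compares $x s$ and $s x$ degree by
    degree, which determines the centralizer of [R]. *)
Lemma skew_mulU0_coef x s a : (skew_mul x << s *g 0 >>)@_a = x@_a * sig a s.
Proof.
elim/malg_ind: x => [|x y IHx IHy|c l]; first by rewrite skew_mul0l mcoeff0 mul0r.
  by rewrite skew_mulDl !mcoeffD IHx IHy mulrDl.
by rewrite skew_mulUU addr0 !mcoeffU; case: eqP => [->|_]; rewrite ?mul0r.
Qed.

(** Left multiplication by $r T^k$ permutes degrees and acts on each coefficient by the injective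
    map $p \mapsto r \sigma_k(p)$. *)
Lemma skew_mul_regular k r y : (forall p, r * p = 0 -> p = 0) ->
  skew_mul << r *g k >> y = 0 -> y = 0.
Proof.
move=> rr y0; apply/malgP => a; rewrite mcoeff0; apply: (@sig_inj0 k); apply: rr.
by rewrite -skew_mulUl_coef y0 mcoeff0.
Qed.

Variables (Gen : choiceType) (dg : Gen -> G) (cf : Gen -> R).

Definition word_degree (w : seq Gen) : G := \sum_(g <- w) dg g.

(** The product of the terms $cf(g) T^{dg(g)}$ along a word equals [word_coef] times $T$ to the
    power [word_degree]. *)
Fixpoint word_coef (w : seq Gen) : R :=
  if w is g :: w' then cf g * sig (dg g) (word_coef w') else 1.

Lemma word_degree_cat w1 w2 : word_degree (w1 ++ w2) = word_degree w1 + word_degree w2.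
Proof. by rewrite /word_degree big_cat. Qed.

Lemma word_coef_cat w1 w2 :
  word_coef (w1 ++ w2) = word_coef w1 * sig (word_degree w1) (word_coef w2).
Proof.
elim: w1 => [|g w IH] /=; first by rewrite /word_degree big_nil sig0 mul1r.
by rewrite IH sig_mul mulrA -sigD /word_degree big_cons.
Qed.

Definition word_term (w : {fmonom Gen}) (c : K) : S :=
  << scal c * word_coef w *g word_degree w >>.

Fact word_term_additive w : {morph word_term w : x y / x - y}.
Proof. by move=> x y; rewrite /word_term rmorphB mulrBl monalgUB. Qed.

HB.instance Definition _ w :=
  GRing.isZmodMorphism.Build K S (word_term w) (word_term_additive w).

Fact skew_coef_sig :
  {c : free_alg K Gen -> S | forall f, c f = malg_lift word_term f}.
Proof. by exists (malg_lift word_term). Qed.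

(** This is the algebra morphism sending each generator $g$ to $cf(g) T^{dg(g)}$, written out on
    words. *)
Definition skew_coef : free_alg K Gen -> S := sval skew_coef_sig.

Lemma skew_coefE f : skew_coef f = malg_lift word_term f.
Proof. exact: svalP skew_coef_sig f. Qed.

Fact skew_coef_is_zmod_morphism : {morph skew_coef : x y / x - y}.
Proof. move=> x y; rewrite !skew_coefE; exact: malg_lift_is_additive. Qed.

HB.instance Definition _ := GRing.isZmodMorphism.Build (free_alg K Gen) S
  skew_coef skew_coef_is_zmod_morphism.

Lemma skew_coef0 : skew_coef 0 = 0.
Proof. exact: raddf0. Qed.

Lemma skew_coefD : {morph skew_coef : x y / x + y}.
Proof. exact: raddfD. Qed.

Lemma skew_coefB : {morph skew_coef : x y / x - y}.
Proof. exact: raddfB. Qed.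

Lemma skew_coefU c (w : {fmonom Gen}) :
  skew_coef << c *g w >> = << scal c * word_coef w *g word_degree w >>.
Proof. by rewrite skew_coefE malg_liftU. Qed.

Lemma skew_coef_scal c : skew_coef (scal c) = << scal c *g 0 >>.
Proof. by rewrite skew_coefU fm1 /= mulr1 /word_degree big_nil. Qed.

Lemma skew_coef_gen g : skew_coef (free_gen K g) = << cf g *g dg g >>.
Proof.
by rewrite skew_coefU fmU /= /word_degree big_seq1 -(@scal1 K R) sig_scal !scal1 mulr1 mul1r.
Qed.

Lemma skew_coefM f g : skew_coef (f * g) = skew_mul (skew_coef f) (skew_coef g).
Proof.
elim/malg_ind: f => [|x y IHx IHy|c v]; first by rewrite mul0r skew_coef0 skew_mul0l.
  rewrite mulrDl (skew_coefD (x * g)) (skew_coefD x) skew_mulDl.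
  exact: (congr2 _ IHx IHy).
elim/malg_ind: g => [|x y IHx IHy|d w]; first by rewrite mulr0 skew_coef0 skew_mul0r.
  rewrite mulrDr (skew_coefD (_ * x)) (skew_coefD x) skew_mulDr.
  exact: (congr2 _ IHx IHy).
rewrite malgM_def fgmulUU !skew_coefU skew_mulUU fmM word_coef_cat word_degree_cat.
rewrite scalM sig_mul sig_scal; congr << _ *g _ >>.
by rewrite !mulrA; congr (_ * _); rewrite -!mulrA [scal d * _]scal_central.
Qed.

#[local] Obligation Tactic := idtac.
(** To factor [skew_coef] through a presented algebra, it suffices that this ideal contains the
    relators, since a generated ideal is the intersection of the ideals containing its
    generators. *)
Program Definition skew_ker : ideal (free_alg K Gen) :=
  @Ideal _ _ [set f | skew_coef f = 0]%classic _ _ _.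
Next Obligation. exact: skew_coef0. Qed.
Next Obligation. by move=> x y /= Sx Sy; rewrite skew_coefD Sx Sy addr0. Qed.
Next Obligation. by move=> a x b /= Sx; rewrite !skew_coefM Sx skew_mul0r skew_mul0l. Qed.

End TwistedCoefficients.

(** * The kernel of the projection onto a TGW algebra *)

Section NormalForm.
Variables (K : comNzRingType) (R : pzAlgType K) (I : choiceType) (C : pzRingType).
Variables (rC : R -> C) (XC YC : I -> C) (sX sY : I -> R -> R) (tX tY : I -> R).
Variables (mu nu : I -> I -> K).
Hypotheses (rC1 : rC 1 = 1) (rCM : {morph rC : r s / r * s})
  (XC_rC : forall i r, XC i * rC r = rC (sX i r) * XC i)
  (YC_rC : forall i r, YC i * rC r = rC (sY i r) * YC i)
  (YC_XC : forall i, YC i * XC i = rC (tY i))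
  (XC_YC : forall i, XC i * YC i = rC (tX i))
  (XC_YC_comm : forall i j, i != j ->
     XC i * YC j = rC (scal (mu i j)) * (YC j * XC i))
  (nu_mu : forall i j, nu i j * mu i j = 1).
Local Notation Gen := (R + I + I)%type.

Definition genC (g : Gen) : C :=
  match g with inl (inl r) => rC r | inl (inr i) => XC i | inr i => YC i end.

Lemma YC_XC_comm i j : i != j -> YC j * XC i = rC (scal (nu i j)) * (XC i * YC j).
Proof.
move=> ij; rewrite XC_YC_comm // mulrA -rCM -scalM nu_mu scal1.
by rewrite rC1 mul1r.
Qed.

Local Notation Xs s := (\prod_(i <- s) XC i).
Local Notation Ys s := (\prod_(i <- s) YC i).

Lemma Ys_rC s r : exists r', Ys s * rC r = rC r' * Ys s.
Proof.
elim: s r => [|i s IH] r; first by exists r; rewrite big_nil mul1r mulr1.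
rewrite big_cons -mulrA; have [r' ->] := IH r; rewrite mulrA YC_rC -mulrA.
by eexists.
Qed.

(** The letter $X_i$ travels to the right, picking up scalars, until it meets a $Y_i$ and is
    absorbed into $X_i Y_i \in R$, or leaves the word. *)
Lemma XC_Ys i s : exists r, XC i * Ys s =
  rC r * (if i \in s then Ys (rem i s) else Ys s * XC i).
Proof.
elim: s => [|j s [r IH]]; first by exists 1; rewrite big_nil rC1 mulr1 !mul1r.
rewrite big_cons /= in_cons eq_sym; case: eqP => [->|/eqP ji] /=.
  by exists (tX i); rewrite mulrA XC_YC.
have ij : i != j by rewrite eq_sym.
exists (scal (mu i j) * sY j r).
rewrite mulrA XC_YC_comm // -2!mulrA IH rCM -mulrA; congr (_ * _).
rewrite mulrA YC_rC -mulrA; congr (_ * _).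
by case: ifP => _; rewrite ?big_cons // mulrA.
Qed.

Lemma YC_Xs i s : i \in s -> exists r, YC i * Xs s = rC r * Xs (rem i s).
Proof.
elim: s => [//|j s IH]; rewrite in_cons eq_sym big_cons /=.
case: eqP => [-> _|/eqP ji /= /IH[r {}IH]].
  by exists (tY i); rewrite mulrA YC_XC.
exists (scal (nu j i) * sX j r).
rewrite mulrA YC_XC_comm // -2!mulrA IH rCM -mulrA; congr (_ * _).
by rewrite mulrA XC_rC -mulrA big_cons.
Qed.

(** The last $Y_i$ is next to the block of $X$'s and cancels against the first $X_i$ there; what
    remains is again a pair of matching words. *)
Lemma Ys_Xs_perm s t : perm_eq s t -> exists r, Ys s * Xs t = rC r.
Proof.
elim/last_ind: s t => [|s i IH] t st.
  have -> : t = [::] by apply/perm_nilP; rewrite perm_sym.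
  by exists 1; rewrite !big_nil mulr1 rC1.
have it : i \in t by rewrite -(perm_mem st) mem_rcons mem_head.
have {}st : perm_eq s (rem i t).
  rewrite -(perm_cons i) -(perm_rcons i s); apply: perm_trans st _.
  exact: perm_to_rem.
rewrite big_rcons -mulrA; have [r ->] := YC_Xs it.
rewrite mulrA; have [r' ->] := Ys_rC s r.
by rewrite -mulrA; have [r2 ->] := IH _ st; exists (r' * r2); rewrite rCM.
Qed.

(** Letters are added on the left: an element of [R] joins the coefficient, $Y_i$ joins the block of
    $Y$'s, and $X_i$ passes through that block by [XC_Ys]. The degree identity keeps both blocks on
    their own side, so that it can be read as an equality of multisets when the word has degree
    zero. *)
Lemma prod_genC_normal_form (s : seq Gen) : exists r ys xs,
  \prod_(g <- s) genC g = rC r * (Ys ys * Xs xs) /\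
  \sum_(g <- s) gen_deg g + \sum_(i <- ys) << i >> = \sum_(i <- xs) << i >> :> {malg I}.
Proof.
elim: s => [|g s [r [ys [xs [IH Id]]]]].
  by exists 1, [::], [::]; rewrite !big_nil !mulr1 rC1 addr0.
rewrite !big_cons IH; case: g => [[r'|i]|i] /=.
- exists (r' * r), ys, xs; rewrite add0r; split=> //.
  by rewrite rCM mulrA.
- rewrite mulrA XC_rC -mulrA [XC i * _]mulrA.
  have [r' ->] := XC_Ys i ys; case: ifP => iys.
    exists (sX i r * r'), (rem i ys), xs; rewrite rCM !mulrA; split=> //.
    by rewrite -Id (big_rem i iys) /= -addrA addrCA.
  exists (sX i r * r'), ys, (i :: xs); rewrite rCM !big_cons !mulrA; split=> //.
  by rewrite -addrA Id.
- rewrite mulrA YC_rC -mulrA [YC i * _]mulrA.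
  exists (sY i r), (i :: ys), xs; rewrite !big_cons mulrA; split=> //.
  by rewrite addrACA addNr add0r.
Qed.

Lemma sum_single_coef (s : seq I) i :
  (\sum_(j <- s) << j >> : {malg I})@_i = (count_mem i s)%:Z.
Proof.
rewrite raddf_sum /=; elim: s => [|j s IH]; first by rewrite big_nil.
by rewrite big_cons IH mcoeffU /= PoszD; case: eqP.
Qed.

Lemma prod_genC_deg0 (s : seq Gen) : \sum_(g <- s) gen_deg g = 0 :> {malg I} ->
  exists r, \prod_(g <- s) genC g = rC r.
Proof.
have [r [ys [xs [-> Id]]]] := prod_genC_normal_form s; move=> s0.
(* The coefficient at [i] of the degree identity counts the occurrences of [i] in [ys] and in
   [xs]. *)
have yx : perm_eq ys xs.
  apply/permP => a; apply/permP: a; rewrite /perm_eq; apply/allP => i _ /=.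
  apply/eqP; have /(congr1 (mcoeff i)) := Id.
  by rewrite s0 add0r !sum_single_coef => -[].
by have [r' ->] := Ys_Xs_perm yx; exists (r * r'); rewrite rCM.
Qed.

End NormalForm.

(** * A TGW algebra inside a skew group ring, by $X_i \mapsto cX_i T^i$ and $Y_i \mapsto cY_i
    T^{-i}$ *)

Section TgwKernel.
Variables (K : comNzRingType) (R : pzAlgType K) (I : choiceType).
Variables (D : tgw_datum R I) (mu nu : I -> I -> K) (cX cY : I -> R).
Variable sig : {malg I} -> R -> R.
Hypotheses (sig_morph : forall k, alg_morphism (sig k))
  (sig0 : forall r, sig 0 r = r)
  (sigD : forall k l r, sig (k + l) r = sig k (sig l r))
  (sigE : forall i r, sig << i >> r = tgw_sigma D i r).
Hypotheses (nu_mu : forall i j, nu i j * mu i j = 1)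
  (cX_central : forall i r, cX i * r = r * cX i)
  (cY_central : forall i r, cY i * r = r * cY i)
  (cX_regular : forall i p, cX i * p = 0 -> p = 0)
  (cY_regular : forall i p, cY i * p = 0 -> p = 0)
  (c_YX : forall i, cY i * sig (- << i >>) (cX i) = tgw_t D i)
  (c_XY : forall i, cX i * sig << i >> (cY i) = tgw_sigma D i (tgw_t D i))
  (c_XYC : forall i j, i != j ->
     cX i * sig << i >> (cY j) = scal (mu i j) * (cY j * sig (- << j >>) (cX i))).

Local Notation Gen := (R + I + I)%type.
Local Notation free := (tgw_free R I).
Local Notation C := (tgw_C D mu).

Definition gen_coef (g : Gen) : R :=
  match g with inl (inl r) => r | inl (inr i) => cX i | inr i => cY i end.

Definition tgw_coef : free -> {malg R[{malg I}]} :=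
  @skew_coef K R {malg I} sig Gen (@gen_deg K R I) gen_coef.

Lemma sigVE i r : tgw_sigmaV D i r = sig (- << i >>) r.
Proof. by rewrite -[r in LHS]sig0 -(subrr << i >>) sigD sigE tgw_sigmaK. Qed.

Lemma tgw_coefM f g : tgw_coef (f * g) = skew_mul sig_morph (tgw_coef f) (tgw_coef g).
Proof. exact: skew_coefM. Qed.

Lemma tgw_coefD : {morph tgw_coef : x y / x + y}.
Proof. exact: skew_coefD. Qed.

Lemma tgw_coefB : {morph tgw_coef : x y / x - y}.
Proof. exact: skew_coefB. Qed.

Lemma tgw_coef_scal c : tgw_coef (scal c) = << scal c *g 0 >>.
Proof. exact: skew_coef_scal. Qed.

Lemma tgw_coef_rgen r : tgw_coef (rgen I r) = << r *g 0 >>.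
Proof. by rewrite /tgw_coef /rgen skew_coef_gen. Qed.

Lemma tgw_coef_Xgen i : tgw_coef (Xgen R i) = << cX i *g << i >> >>.
Proof. by rewrite /tgw_coef /Xgen skew_coef_gen. Qed.

Lemma tgw_coef_Ygen i : tgw_coef (Ygen R i) = << cY i *g - << i >> >>.
Proof. by rewrite /tgw_coef /Ygen skew_coef_gen. Qed.

Lemma tgw_coef_mulU f g k r l s : tgw_coef f = << r *g k >> ->
  tgw_coef g = << s *g l >> -> tgw_coef (f * g) = << r * sig k s *g k + l >>.
Proof. move=> fE gE; rewrite tgw_coefM fE gE; exact: skew_mulUU. Qed.

(** The relations moving $X_i$ and $Y_i$ past [R] hold because [cX] and [cY] are central; those
    among the $X_i$ and $Y_j$ are the hypotheses [c_YX], [c_XY] and [c_XYC]. *)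
Lemma tgw_coef_rel f g : tgw_rel D mu f g -> tgw_coef f = tgw_coef g.
Proof.
case=> [c|r s|r s|i r|i r|i|i|i j ij].
- by rewrite tgw_coef_rgen tgw_coef_scal.
- by rewrite tgw_coefD !tgw_coef_rgen monalgUD.
- by rewrite tgw_coefM !tgw_coef_rgen skew_mulUU sig0 addr0.
- apply: (eq_trans (tgw_coef_mulU (tgw_coef_Xgen i) (tgw_coef_rgen r))); apply: esym.
  apply: (eq_trans (tgw_coef_mulU (tgw_coef_rgen _) (tgw_coef_Xgen i))).
  by rewrite sigE addr0 add0r sig0 cX_central.
- apply: (eq_trans (tgw_coef_mulU (tgw_coef_Ygen i) (tgw_coef_rgen r))); apply: esym.
  apply: (eq_trans (tgw_coef_mulU (tgw_coef_rgen _) (tgw_coef_Ygen i))).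
  by rewrite sigVE addr0 add0r sig0 cY_central.
- apply: (eq_trans (tgw_coef_mulU (tgw_coef_Ygen i) (tgw_coef_Xgen i))); apply: esym.
  by apply: (eq_trans (tgw_coef_rgen _)); rewrite addNr c_YX.
- apply: (eq_trans (tgw_coef_mulU (tgw_coef_Xgen i) (tgw_coef_Ygen i))); apply: esym.
  by apply: (eq_trans (tgw_coef_rgen _)); rewrite addrN c_XY.
- apply: (eq_trans (tgw_coef_mulU (tgw_coef_Xgen i) (tgw_coef_Ygen j))); apply: esym.
  apply: (eq_trans (tgw_coef_mulU (tgw_coef_scal _)
    (tgw_coef_mulU (tgw_coef_Ygen j) (tgw_coef_Xgen i)))).
  by rewrite sig0 add0r (c_XYC ij) [- << j >> + _]addrC.
Qed.

Definition piC (f : free) : C := quot_pi _ f.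

Lemma piC_rel f g : tgw_rel D mu f g -> piC f = piC g.
Proof. by move=> fg; apply/quot_pi_eq => J; apply; exists (f, g). Qed.

(** The coefficient map factors through [C], because its kernel is one of the ideals containing the
    relators. *)
Lemma piC_coef f g : piC f = piC g -> tgw_coef f = tgw_coef g.
Proof.
move/quot_pi_eq => /(_ (skew_ker sig_morph sig0 sigD (@gen_deg K R I) gen_coef)) /= h.
apply/eqP; rewrite -subr_eq0 -tgw_coefB; apply/eqP/h => _ [[a b]] /= ab <-.
by rewrite -/(tgw_coef _) tgw_coefB (tgw_coef_rel ab) subrr.
Qed.

Lemma piCM f g : piC (f * g) = piC f * piC g.
Proof. exact: quot_piM. Qed.

Lemma piCD f g : piC (f + g) = piC f + piC g.
Proof. exact: quot_piD. Qed.

Lemma piC0 : piC 0 = 0.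
Proof. by apply: (addrI (piC 0)); rewrite -piCD !addr0. Qed.

Lemma piCB f g : piC (f - g) = piC f - piC g.
Proof. by apply: (addIr (piC g)); rewrite -piCD !subrK. Qed.

Definition rC r : C := piC (rgen I r).
Definition XC i : C := piC (Xgen R i).
Definition YC i : C := piC (Ygen R i).

Lemma rC_scal c : rC (scal c) = scal c.
Proof. rewrite /rC; exact: (piC_rel (rel_scal D mu c)). Qed.

Lemma rC1 : rC 1 = 1.
Proof. by rewrite -(@scal1 K R) rC_scal scal1. Qed.

Lemma rC0 : rC 0 = 0.
Proof. by rewrite -(raddf0 (@scal K R)) rC_scal raddf0. Qed.

Lemma rCM r s : rC (r * s) = rC r * rC s.
Proof. rewrite /rC -piCM; exact: (piC_rel (rel_mul D mu r s)). Qed.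

Lemma rCD r s : rC (r + s) = rC r + rC s.
Proof. rewrite /rC -piCD; exact: (piC_rel (rel_add D mu r s)). Qed.

Lemma XC_rC i r : XC i * rC r = rC (tgw_sigma D i r) * XC i.
Proof. rewrite /rC /XC -!piCM; exact: (piC_rel (rel_Xr D mu i r)). Qed.

Lemma YC_rC i r : YC i * rC r = rC (tgw_sigmaV D i r) * YC i.
Proof. rewrite /rC /YC -!piCM; exact: (piC_rel (rel_Yr D mu i r)). Qed.

Lemma YC_XC i : YC i * XC i = rC (tgw_t D i).
Proof. rewrite /rC /YC /XC -!piCM; exact: (piC_rel (rel_YX D mu i)). Qed.

Lemma XC_YC i : XC i * YC i = rC (tgw_sigma D i (tgw_t D i)).
Proof. rewrite /rC /YC /XC -!piCM; exact: (piC_rel (rel_XY D mu i)). Qed.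

Lemma XC_YC_comm i j : i != j -> XC i * YC j = rC (scal (mu i j)) * (YC j * XC i).
Proof.
move=> ij; rewrite rC_scal /XC /YC -!piCM; exact: (piC_rel (rel_XYC D mu ij)).
Qed.

Definition word (s : seq Gen) : free := << 1 *g (FMonom s : {fmonom Gen}) >>.

Lemma word_cons g s : word (g :: s) = free_gen K g * word s.
Proof. by rewrite /word /free_gen malgM_def fgmulUU mulr1 /mmul /= fmmulE fmU. Qed.

Lemma word_nil : word [::] = 1.
Proof. by rewrite /word -fmoneE. Qed.

Lemma piC_word s : piC (word s) = \prod_(g <- s) genC rC XC YC g.
Proof.
elim: s => [|g s IH]; first by rewrite word_nil big_nil.
by rewrite word_cons piCM IH big_cons; case: g => [[]|].
Qed.

Lemma word_deg0 (s : seq Gen) : \sum_(g <- s) gen_deg g = 0 :> {malg I} ->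
  exists r, piC (word s) = rC r.
Proof.
rewrite piC_word; apply: (prod_genC_deg0 rC1 rCM XC_rC YC_rC YC_XC XC_YC XC_YC_comm nu_mu).
Qed.

(** The degree zero part of [C] is the image of [R], since every word of degree zero reduces to an
    element of [R]. *)
Lemma homog0_rC (f : free) : (forall w, w \in msupp f -> word_deg w = 0) ->
  exists r, piC f = rC r.
Proof.
move=> f0; rewrite (monalgE f) big_seq.
apply: (big_ind (fun f => exists r, piC f = rC r)).
- by exists 0; rewrite rC0 piC0.
- by move=> x y [r rE] [s sE]; exists (r + s); rewrite rCD piCD rE sE.
move=> w /f0 w0; have [r rE] := word_deg0 w0.
exists (scal f@_w * r); rewrite rCM rC_scal -rE.
have -> : << f@_w *g w >> = (scal f@_w : free) * word w.
  by rewrite /word fmK mul_malgC malgZ_def /fgscale msuppU oner_eq0 big_seq_fset1 mcoeffUU mulr1.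
by rewrite piCM.
Qed.

Definition regular_word (d : {malg I}) := exists s : seq Gen,
  word_degree (@gen_deg K R I) s = d /\
  forall p, word_coef sig (@gen_deg K R I) gen_coef s * p = 0 -> p = 0.

(** The degrees of $X_i$ and $Y_i$ generate the grading group as a monoid, their coefficients are
    regular, and regularity survives concatenation. *)
Lemma exists_regular_word d : regular_word d.
Proof.
have sum k l : regular_word k -> regular_word l -> regular_word (k + l).
  move=> [s [sk sr]] [t [tl tr]]; exists (s ++ t); split.
    by rewrite word_degree_cat sk tl.
  move=> p; rewrite word_coef_cat // -mulrA => /sr.
  (* The coefficient of the second word is twisted by the degree of the first; applying the inverse
     automorphism removes the twist before cancelling. *)
  move=> /(congr1 (sig (- word_degree (@gen_deg K R I) s))).
  case: (sig_morph (- word_degree (@gen_deg K R I) s)) => _ _ ->.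
  rewrite -sigD addNr sig0 => h.
  apply: (sig_inj0 sig_morph sig0 sigD (k := - word_degree (@gen_deg K R I) s)).
  apply: tr; rewrite h -[0 in LHS](raddf0 (@scal K R)).
  by case: (sig_morph (- word_degree (@gen_deg K R I) s)) => -> _ _; rewrite raddf0.
have one g : (forall p, gen_coef g * p = 0 -> p = 0) -> regular_word (gen_deg g).
  move=> gr; exists [:: g]; rewrite /word_degree big_seq1; split=> // p /=.
  have -> : sig (gen_deg g) 1 = 1.
    by rewrite -(@scal1 K R); case: (sig_morph (gen_deg g)) => -> _ _.
  by rewrite mulr1 => /gr.
have zero : regular_word 0.
  by exists [::]; rewrite /word_degree big_nil; split=> // p /=; rewrite mul1r.
have mulrn k n : regular_word k -> regular_word (k *+ n).
  by move=> kr; elim: n => [//|n IH]; rewrite mulrS; exact: sum.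
apply: malg_ind d => // -[] n i.
  have -> : << Posz n *g i >> = << i >> *+ n :> {malg I}.
    by rewrite -monalgUMn; congr << _ *g _ >>; lia.
  by apply: (mulrn _ _); exact: (one (inl (inr i)) (cX_regular (i := i))).
have -> : << Negz n *g i >> = (- << i >>) *+ n.+1 :> {malg I}.
  by rewrite -monalgUN -monalgUMn; congr << _ *g _ >>; lia.
by apply: (mulrn _ _); exact: (one (inr i) (cY_regular (i := i))).
Qed.

Lemma tgw_coef_word s :
  tgw_coef (word s) = << word_coef sig (@gen_deg K R I) gen_coef s
                         *g word_degree (@gen_deg K R I) s >>.
Proof. by rewrite /tgw_coef skew_coefU scal1 mul1r. Qed.

Definition homog_part (d : {malg I}) (f : free) : free :=
  \sum_(w <- msupp f | word_deg w == d) << f@_w *g w >>.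

Lemma homog_part_supp d f w : w \in msupp (homog_part d f) -> word_deg w = d.
Proof.
rewrite -mcoeff_neq0; apply: contra_neq_eq => wd.
rewrite raddf_sum big1 //= => v /eqP vd; rewrite mcoeffU.
by case: eqP => // vw; rewrite -vd vw eqxx in wd.
Qed.

Lemma homog_part_coef d f : tgw_coef (homog_part d f) = << (tgw_coef f)@_d *g d >>.
Proof.
apply/malgP => a; rewrite mcoeffU {2}(monalgE f) /homog_part /tgw_coef !raddf_sum /=.
rewrite [LHS]big_mkcond -sumrMnl; apply: eq_bigr => w _.
rewrite skew_coefU !mcoeffU -/(word_deg w) -/(word_degree _ w).
rewrite (_ : word_degree _ w = word_deg w); last by [].
by case: eqP => [->|_]; rewrite ?mulr1n // mulr0n mul0rn.
Qed.

Lemma homog_part_sum f :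
  f = \sum_(d <- [fset word_deg w | w in msupp f]%fset) homog_part d f.
Proof. by rewrite [LHS]monalgE (partition_big_imfset _ (@word_deg K R I)). Qed.

#[local] Obligation Tactic := idtac.
(** The next two lemmas show that this is one of the ideals whose sum is the radical, which gives
    one of the two inclusions between the radical and the kernel. *)
Program Definition coef_kerC : ideal C :=
  @Ideal _ C [set x | exists2 f : free, x = piC f & tgw_coef f = 0]%classic _ _ _.
Next Obligation. by exists 0; [rewrite piC0|exact: skew_coef0]. Qed.
Next Obligation.
move=> _ _ [f -> f0] [g -> g0]; exists (f + g); first by rewrite piCD.
by rewrite tgw_coefD f0 g0 addr0.
Qed.
Next Obligation.
move=> a _ b [f -> f0]; exists (quot_repr a * f * quot_repr b).
  by rewrite !piCM /piC !quot_reprK.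
by rewrite !tgw_coefM f0 skew_mul0r skew_mul0l.
Qed.

Lemma coef_kerC_graded : graded_ideal coef_kerC.
Proof.
move=> _ [f -> f0]; exists [seq piC (homog_part d f) | d <- [fset word_deg w | w in msupp f]%fset].
  move=> _ /mapP[d _ ->]; split; last by exists d, (homog_part d f) => // w /homog_part_supp.
  by exists (homog_part d f) => //; rewrite homog_part_coef f0 mcoeff0 monalgU0.
rewrite big_map {1}(homog_part_sum f).
by apply: (big_morph piC); [exact: piCD|exact: piC0].
Qed.

(** A degree zero element comes from some [r] in [R], and [r] is recovered from its image $r
    T^0$. *)
Lemma coef_kerC_deg0 x : coef_kerC x -> tgw_C_homog 0 x -> x = 0.
Proof.
move=> [f -> f0] [g /homog0_rC[r gr]]; rewrite -/(piC g) gr => fr; rewrite fr.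
have := piC_coef fr; rewrite f0 tgw_coef_rgen => /(congr1 (mcoeff 0)).
by rewrite mcoeff0 mcoeffUU => <-; exact: rC0.
Qed.

(** Let $y$ be homogeneous of degree $d$ in a graded ideal meeting degree zero trivially. Its
    product with a word of degree $-d$ lies in the ideal and in degree zero, hence vanishes; if the
    word is regular, the coefficient of $y$ vanishes too. *)
Lemma radical_coef f : tgw_radical D mu (piC f) -> tgw_coef f = 0.
Proof.
move=> [s sJ fs].
suff {f fs} h y : y \in s -> coef_kerC y.
  have [g fg g0] : coef_kerC (piC f).
    rewrite fs big_seq; apply: (big_ind coef_kerC) => //; first exact: ideal0.
    exact: idealD.
  by rewrite (piC_coef fg).
move=> {s sJ} /sJ[J [Jgr J0]] /Jgr[s sJ ->]; rewrite big_seq.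
apply: (big_ind coef_kerC); [exact: ideal0|exact: idealD|].
move=> {}y /sJ[Jy [d [f fd yf]]].
exists f => //; have [t [td tr]] := exists_regular_word (- d).
have bf0 : word t * f = \sum_(w <- msupp f) << f@_w *g mmul (FMonom t : {fmonom Gen}) w >>.
  by rewrite malgM_def fgmulUg; apply: eq_bigr => w _; rewrite mul1r.
have : piC (word t * f) = 0.
  apply: J0.
    rewrite piCM -[piC f]mulr1 mulrA -/(piC f); apply: idealM.
    by rewrite /piC -yf.
  exists (word t * f) => // w; rewrite bf0 -mcoeff_neq0; apply: contra_neq_eq => wd.
  rewrite raddf_sum big_seq big1 //= => v /fd vd; rewrite mcoeffU.
  case: eqP => // vw; move: wd; rewrite -vw /word_deg /mmul /= fmmulE big_cat /=.
  by rewrite -/(word_deg v) vd -/(word_degree _ t) td addNr eqxx.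
rewrite -piC0 => /piC_coef; rewrite tgw_coefM tgw_coef_word /tgw_coef skew_coef0.
exact: (@skew_mul_regular _ _ _ _ sig_morph sig0 sigD _ _ _ tr).
Qed.

Lemma tgw_of_free_eq f g :
  tgw_of_free D mu f = tgw_of_free D mu g <-> tgw_coef f = tgw_coef g.
Proof.
rewrite /tgw_of_free; split=> [/quot_pi_eq|fg].
  rewrite -/(piC f) -/(piC g) -piCB => /radical_coef/eqP.
  by rewrite tgw_coefB subr_eq0 => /eqP.
apply/quot_pi_eq; exists [:: piC (f - g)]; last by rewrite big_seq1 piCB.
move=> y; rewrite inE => /eqP ->; exists coef_kerC.
  by split; [exact: coef_kerC_graded|exact: coef_kerC_deg0].
by exists (f - g) => //; rewrite tgw_coefB fg subrr.
Qed.

End TgwKernel.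

(** * The Weyl algebra *)

Section CommutingProducts.
Variables (B : pzRingType) (I : choiceType) (F : I -> B).
Hypothesis F_comm : forall i j, GRing.comm (F i) (F j).

Lemma comm_prod_rem i (s : seq I) : i \in s ->
  \prod_(j <- s) F j = F i * \prod_(j <- rem i s) F j.
Proof.
elim: s => [//|j s IH]; rewrite in_cons eq_sym big_cons /=.
case: eqP => [-> //|_ /= /IH ->]; rewrite big_cons !mulrA.
by congr (_ * _); exact: F_comm.
Qed.

Lemma comm_prod_perm (s t : seq I) : perm_eq s t ->
  \prod_(j <- s) F j = \prod_(j <- t) F j.
Proof.
elim: s t => [|i s IH] t st; first by have -> : t = [::] by apply/perm_nilP; rewrite perm_sym.
have it : i \in t by rewrite -(perm_mem st) mem_head.
rewrite big_cons (comm_prod_rem it) (IH (rem i t)) //.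
by rewrite -(perm_cons i); apply: perm_trans st _; exact: perm_to_rem.
Qed.

(** Products in a noncommutative ring follow the enumeration of the finite set, so enlarging the set
    reorders the factors and uses that they commute. *)
Lemma comm_prod_fset_incl (a d : {fset I}) : (a `<=` d)%fset ->
  (forall i, i \notin a -> F i = 1) -> \prod_(i <- a) F i = \prod_(i <- d) F i.
Proof.
move=> ad F1; rewrite (@comm_prod_perm d (a ++ (d `\` a)%fset)).
  rewrite big_cat /= [X in _ * X]big1_seq ?mulr1 //= => i.
  by rewrite in_fsetD => /andP[/F1].
apply: uniq_perm; rewrite ?fset_uniq // ?cat_uniq ?fset_uniq ?andbT //=.
  by apply/hasPn => i; rewrite in_fsetD => /andP[].
move=> i; rewrite mem_cat in_fsetD; case ia : (i \in a) => //=.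
by rewrite (fsubsetP ad).
Qed.
End CommutingProducts.

(** * Evaluation of polynomials at commuting elements of a noncommutative algebra *)

Section CommutingEvaluation.
Variables (K : comNzRingType) (E : choiceType) (B : pzAlgType K) (h : E -> B).
Hypothesis h_comm : forall e f, h e * h f = h f * h e.

Let mon (m : {cmonom E}) : B := \prod_(e <- finsupp m) h e ^+ m e.

Let hX_comm (m n : {cmonom E}) e f : GRing.comm (h e ^+ m e) (h f ^+ n f).
Proof. by apply/commrX/commr_sym/commrX/commr_sym/h_comm. Qed.

Let monEw (d : {fset E}) (m : {cmonom E}) : (finsupp m `<=` d)%fset ->
  mon m = \prod_(e <- d) h e ^+ m e.
Proof.
move=> md; apply: (comm_prod_fset_incl (F := fun e => h e ^+ m e)) => //.
by move=> e; rewrite -cmE_eq0 => /eqP ->; rewrite expr0.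
Qed.

Let monM (m n : {cmonom E}) : mon (mmul m n) = mon m * mon n.
Proof.
rewrite (monEw (fsubsetUl (finsupp m) (finsupp n))).
rewrite (monEw (fsubsetUr (finsupp m) (finsupp n))) -prodrM_comm //.
rewrite /mon mdomD; apply: eq_bigr => e _; rewrite cmM; exact: exprD.
Qed.

Let term (m : {cmonom E}) (c : K) : B := scal c * mon m.

Let term_additive m : {morph term m : x y / x - y}.
Proof. by move=> x y; rewrite /term raddfB mulrBl. Qed.

Let termM m n c d : term (mmul m n) (c * d) = term m c * term n d.
Proof.
rewrite /term monM scalM -!mulrA; congr (_ * _).
by rewrite !mulrA; congr (_ * _); exact: scal_central.
Qed.

HB.instance Definition _ m :=
  GRing.isZmodMorphism.Build K B (term m) (term_additive m).

Let poly_evalE (p : poly_alg K E) : poly_eval h p = malg_lift term p.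
Proof. by []. Qed.

Lemma comm_poly_eval_morphism : alg_morphism (poly_eval h : poly_alg K E -> B).
Proof.
split=> [c|p q|p q]; rewrite !poly_evalE.
- rewrite malg_liftU /= /term /mon mdom1 big_seq_fset0; exact: mulr1.
- exact: malg_liftD.
by apply: malg_liftM => m n c d; exact: termM.
Qed.

Lemma comm_poly_eval_var e : poly_eval h (poly_var K e) = h e.
Proof.
by rewrite poly_evalE malg_liftU /= /term /mon mdomU big_seq_fset1 cmUU expr1 scal1 mul1r.
Qed.
End CommutingEvaluation.

(** * Consequences of the Weyl relations: the span of the monomials $z^k$ over the polynomials in
    $y_e x_e$ *)

Section WeylRelations.
Variables (K : comNzRingType) (E : choiceType) (B : pzAlgType K) (x y : E -> B).
Hypotheses (xx : forall e f, x e * x f = x f * x e)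
  (yy : forall e f, y e * y f = y f * y e)
  (yx : forall e f, y e * x f = x f * y e + (e == f)%:R).
Local Notation P := (poly_alg K E).
Local Notation u := (@poly_var K E).

Let xy e f : e != f -> x e * y f = y f * x e.
Proof. by move=> ef; rewrite yx eq_sym (negbTE ef) addr0. Qed.

Let xyx e : x e * y e = y e * x e - 1.
Proof. by rewrite yx eqxx addrK. Qed.

Let h e := y e * x e.

Let h_comm e f : h e * h f = h f * h e.
Proof.
rewrite /h; have [-> //|ef] := eqVneq e f.
rewrite -mulrA [x e * _]mulrA xy // -mulrA [x e * _]xx mulrA yy -!mulrA.
congr (_ * _); rewrite !mulrA; congr (_ * _); rewrite xy //.
by rewrite eq_sym.
Qed.

Definition weyl_ev : P -> B := poly_eval h.

Lemma weyl_ev_morphism : alg_morphism weyl_ev.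
Proof. exact: comm_poly_eval_morphism. Qed.

Lemma weyl_ev_var e : weyl_ev (u e) = y e * x e.
Proof. exact: comm_poly_eval_var. Qed.

Let evC c : weyl_ev (scal c) = scal c. Proof. by case: weyl_ev_morphism. Qed.
Let evD : {morph weyl_ev : p q / p + q}. Proof. by case: weyl_ev_morphism. Qed.
Let evM : {morph weyl_ev : p q / p * q}. Proof. by case: weyl_ev_morphism. Qed.
Let ev0 : weyl_ev 0 = 0.
Proof. by apply: (addrI (weyl_ev 0)); rewrite -evD !addr0. Qed.
Let ev1 : weyl_ev 1 = 1. Proof. by have := evC 1; rewrite !scal1. Qed.
Let evB1 p : weyl_ev (p - 1) = weyl_ev p - 1.
Proof. by apply: (addIr 1); rewrite -[X in _ + X = _]ev1 -evD !subrK. Qed.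
Let evD1 p : weyl_ev (p + 1) = weyl_ev p + 1.
Proof. by rewrite evD ev1. Qed.

(** For the variable [u e] this is $x_e y_e x_e = (y_e x_e - 1) x_e$, the other variables commute
    with $x_e$, and the rule is compatible with sums and products. *)
Lemma weyl_x_ev e p : x e * weyl_ev p = weyl_ev (shift << e >> p) * x e.
Proof.
move: p; apply: poly_alg_ind => [c|f|p q IHp IHq|p q IHp IHq].
- by rewrite shiftC evC scal_central.
- rewrite shift_u mcoeffU; case: eqP => [<-|/eqP ef].
    by rewrite evB1 weyl_ev_var mulrA xyx.
  rewrite subr0 weyl_ev_var mulrA xy // -!mulrA; congr (_ * _); exact: xx.
- by rewrite evD shift_add evD mulrDr mulrDl IHp IHq.
- by rewrite evM shift_mul evM mulrA IHp -!mulrA IHq.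
Qed.

Lemma weyl_y_ev e p : y e * weyl_ev p = weyl_ev (shift (- << e >>) p) * y e.
Proof.
move: p; apply: poly_alg_ind => [c|f|p q IHp IHq|p q IHp IHq].
- by rewrite shiftC evC scal_central.
- rewrite shift_u mcoeffN mcoeffU; case: eqP => [<-|/eqP ef].
    by rewrite opprK evD1 weyl_ev_var mulrDl -!mulrA xyx mulrBr mul1r mulr1 subrK.
  rewrite oppr0 addr0 weyl_ev_var mulrA yy -!mulrA; congr (_ * _).
  by rewrite xy // eq_sym.
- by rewrite evD shift_add evD mulrDr mulrDl IHp IHq.
- by rewrite evM shift_mul evM mulrA IHp -!mulrA IHq.
Qed.

(** Same formula as [weyl_zpow], and [zmon] as [weyl_z], so that they agree by conversion at the
    generators of the Weyl algebra. *)
Definition zpow (e : E) (p : int) : B :=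
  if 0 <= p then x e ^+ `|p|%N else y e ^+ `|p|%N.

Definition zmon (k : {malg E}) : B := \prod_(e <- msupp k) zpow e k@_e.

Let zpow_comm e f p q : e != f -> GRing.comm (zpow e p) (zpow f q).
Proof.
have comm2 (a b : B) m n : a * b = b * a -> GRing.comm (a ^+ m) (b ^+ n).
  by move=> ab; apply/commrX/commr_sym/commrX/commr_sym/ab.
move=> ef; rewrite /zpow; case: ifP => _; case: ifP => _; apply: comm2 => //.
  exact: xy.
by apply: esym; apply: xy; rewrite eq_sym.
Qed.

Let zpow_comm_k (k : {malg E}) e f : GRing.comm (zpow e k@_e) (zpow f k@_f).
Proof. by have [->|/zpow_comm] := eqVneq e f. Qed.

Let zmon_factor (d : {fset E}) (k : {malg E}) e : (msupp k `<=` d)%fset -> e \in d ->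
  zmon k = zpow e k@_e * \prod_(f <- rem e d) zpow f k@_f.
Proof.
move=> kd ed; rewrite -(comm_prod_rem (F := fun f => zpow f k@_f)) //.
apply: (comm_prod_fset_incl (F := fun f => zpow f k@_f)) => // f.
by move/mcoeff_outdom => ->.
Qed.

(** Over a common index set containing [e] and both supports, the commuting factor at [e] is brought
    to the front; all other factors of the two monomials agree, so only powers of $z_e$ matter. *)
Let zmon_step (e : E) (b : B) (k : {malg E}) (p : int) :
  (exists c, b * zpow e k@_e = weyl_ev c * zpow e (k@_e + p)) ->
  exists c, b * zmon k = weyl_ev c * zmon (k + << p *g e >>).
Proof.
move=> [c bE]; exists c.
pose d := (e |` (msupp k `|` msupp (k + << p *g e >>)))%fset.
have ed : e \in d by rewrite !inE eqxx.
rewrite (@zmon_factor d k e) //; last first.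
  by apply/fsubsetP => f; rewrite !inE => ->; rewrite orbT.
rewrite (@zmon_factor d (k + _) e) //; last first.
  by apply/fsubsetP => f fk; rewrite in_fset1U in_fsetU fk !orbT.
rewrite mcoeffD mcoeffUU !mulrA -bE; congr (_ * _).
apply: eq_big_seq => f; rewrite mem_rem_uniq ?fset_uniq // inE => /andP[fe _].
by rewrite mcoeffD mcoeffU eq_sym (negbTE fe) addr0.
Qed.

Lemma weyl_x_zmon e k : exists c, x e * zmon k = weyl_ev c * zmon (k + << e >>).
Proof.
apply: zmon_step; case: k@_e => n.
  by exists 1; rewrite ev1 mul1r -PoszD addn1 /zpow /= exprS.
(* For a negative exponent, $x_e y_e^{n+1} = (u_e - 1) y_e^n$. *)
exists (u e - 1); rewrite evB1 weyl_ev_var -xyx.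
have -> : Negz n + 1 = - n%:Z by lia.
rewrite {1}/zpow /= exprS mulrA; congr (_ * _); rewrite /zpow.
(* At [n = 0] the exponent reaches zero and [zpow] switches from $y_e$ to $x_e$, both powers being
   1. *)
by case: n => [|n] //=.
Qed.

Lemma weyl_y_zmon e k : exists c, y e * zmon k = weyl_ev c * zmon (k - << e >>).
Proof.
rewrite -monalgUN; apply: zmon_step; case: k@_e => [[|n]|n].
- by exists 1; rewrite ev1 mul1r /zpow /= expr0 mulr1 expr1.
- exists (u e); rewrite weyl_ev_var.
  have -> : n.+1%:Z + -1 = n%:Z by lia.
  by rewrite /zpow /= exprS mulrA.
- exists 1; have -> : Negz n + -1 = Negz n.+1 by lia.
  by rewrite ev1 mul1r /zpow /= -exprS.
Qed.

(** The coefficients form a total function vanishing off [d], so that two expansions can be added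
    over the union of their index sets. *)
Definition weyl_span (b : B) := exists (d : {fset {malg E}}) (r : {malg E} -> P),
  (forall k, k \notin d -> r k = 0) /\ b = \sum_(k <- d) weyl_ev (r k) * zmon k.

Lemma weyl_span0 : weyl_span 0.
Proof. by exists fset0, (fun=> 0); rewrite big_seq_fset0. Qed.

Lemma weyl_spanD a b : weyl_span a -> weyl_span b -> weyl_span (a + b).
Proof.
move=> [d [r [r0 ->]]] [d' [r' [r'0 ->]]].
exists (d `|` d')%fset, (fun k => r k + r' k); split.
  move=> k; rewrite in_fsetU negb_or => /andP[kd kd'].
  by rewrite r0 // r'0 // addr0.
under [RHS]eq_bigr do rewrite evD mulrDl.
rewrite big_split /=; congr (_ + _); apply: big_fset_incl.
- exact: fsubsetUl.
- by move=> k _ /r0 ->; rewrite ev0 mul0r.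
- exact: fsubsetUr.
- by move=> k _ /r'0 ->; rewrite ev0 mul0r.
Qed.

Lemma weyl_span_term p k : weyl_span (weyl_ev p * zmon k).
Proof.
exists [fset k]%fset, (fun l => if l == k then p else 0); split.
  by move=> l; rewrite inE => /negbTE ->.
by rewrite big_seq_fset1 eqxx.
Qed.

Lemma weyl_span_mul a b :
  (forall p k, weyl_span (a * (weyl_ev p * zmon k))) -> weyl_span b -> weyl_span (a * b).
Proof.
move=> aS [d [r [_ ->]]]; rewrite mulr_sumr.
by apply: (big_ind weyl_span) => //; [exact: weyl_span0|exact: weyl_spanD].
Qed.

Lemma weyl_span_x e b : weyl_span b -> weyl_span (x e * b).
Proof.
apply: weyl_span_mul => p k; rewrite mulrA weyl_x_ev -mulrA.
by have [c ->] := weyl_x_zmon e k; rewrite mulrA -evM; exact: weyl_span_term.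
Qed.

Lemma weyl_span_y e b : weyl_span b -> weyl_span (y e * b).
Proof.
apply: weyl_span_mul => p k; rewrite mulrA weyl_y_ev -mulrA.
by have [c ->] := weyl_y_zmon e k; rewrite mulrA -evM; exact: weyl_span_term.
Qed.

Lemma weyl_span_scal c b : weyl_span b -> weyl_span (scal c * b).
Proof.
apply: weyl_span_mul => p k; rewrite mulrA -evC -evM; exact: weyl_span_term.
Qed.

Lemma weyl_span1 : weyl_span 1.
Proof.
have := weyl_span_term 1 0; rewrite ev1 mul1r /zmon msupp0 big_seq_fset0.
by [].
Qed.
End WeylRelations.

(** * Maximal commutative subalgebras and centralizers *)

Section MaximalCommutative.
Variables (K : comPzRingType) (A : pzAlgType K) (S : set A).

(* Adjoining [a] to [S]: the bicommutant of a commuting set is commutative. *)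
Lemma max_comm_subalgebra_centralizer a : max_comm_subalgebra S ->
  (forall s, S s -> a * s = s * a) -> S a.
Proof.
move=> [[_ Scomm] Smax] aS.
pose Sa : set A := [set b | S b \/ b = a]%classic.
pose comm2 : set A := [set b | forall c, Sa c -> b * c = c * b]%classic.
pose T : set A := [set b | forall c, comm2 c -> b * c = c * b]%classic.
have SaT b : Sa b -> T b by move=> Sb c /(_ b Sb).
have Sa_comm b : Sa b -> comm2 b.
  move=> [Sb|->] c [Sc|->] //; [exact: Scomm|exact/esym/aS|exact: aS].
suff <- : T = S by apply: SaT; right.
apply: Smax => [|b Sb]; last by apply: SaT; left.
split; first split.
- by move=> c b _; rewrite scal_central.
- by move=> b c Tb Tc d cd; rewrite mulrDl mulrDr Tb // Tc.
- by move=> b c Tb Tc d cd; rewrite -mulrA Tc // mulrA Tb // mulrA.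
by move=> b c Tb Tc; apply: Tb => d Sd; apply: Tc; exact: Sa_comm.
Qed.

Lemma centralizer_max_comm_subalgebra : comm_subalgebra S ->
  (forall a, (forall s, S s -> a * s = s * a) -> S a) -> max_comm_subalgebra S.
Proof.
move=> Scs cS; split=> // T [_ Tcomm] ST; apply/seteqP; split=> // a Ta.
by apply: cS => s /ST Ts; exact: Tcomm.
Qed.
End MaximalCommutative.

(** * Pushforward of degrees along a group homomorphism *)

Section Pushforward.
Variables (M : zmodType) (G H : zmodType) (gam : {additive G -> H}).

Definition malg_pushU (a : G) (r : M) : {malg M[H]} := << r *g gam a >>.

Fact malg_pushU_additive a : {morph malg_pushU a : x y / x - y}.
Proof. by move=> x y; rewrite /malg_pushU monalgUB. Qed.

HB.instance Definition _ a :=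
  GRing.isZmodMorphism.Build M {malg M[H]} (malg_pushU a) (malg_pushU_additive a).

Definition malg_push : {malg M[G]} -> {malg M[H]} := malg_lift malg_pushU.

Lemma malg_pushE a r : malg_push << r *g a >> = << r *g gam a >>.
Proof. by rewrite /malg_push malg_liftU. Qed.

Lemma malg_push_inj : injective gam -> injective malg_push.
Proof.
move=> gam_inj; suff pE x a : (malg_push x)@_(gam a) = x@_a.
  by move=> x y xy; apply/malgP => a; rewrite -!pE xy.
elim/malg_ind: x => [|x y IHx IHy|c k].
- by rewrite /malg_push malg_lift0 !mcoeff0.
- by rewrite /malg_push malg_liftD !mcoeffD -!/(malg_push _) IHx IHy.
- by rewrite /malg_push malg_liftU /= /malg_pushU !mcoeffU (inj_eq gam_inj).
Qed.
End Pushforward.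

(** * Evaluation of a free algebra followed by a map to a skew group ring *)

Section Transport.
Variables (K : comNzRingType) (R B : pzAlgType K) (G H : zmodType).
Variables (gam : {additive G -> H}) (sig : H -> R -> R) (psi : B -> {malg R[H]}).
Hypotheses (psiD : {morph psi : x y / x + y})
  (psi_scal : forall c, psi (scal c) = << scal c *g 0 >>)
  (psi_mulU : forall a b k r l s, psi a = << r *g k >> -> psi b = << s *g l >> ->
     psi (a * b) = << r * sig k s *g k + l >>)
  (sig0 : forall r, sig 0 r = r).
Variables (Gen : choiceType) (dg : Gen -> G) (cf : Gen -> R) (h : Gen -> B).
Hypothesis psi_h : forall g, psi (h g) = << cf g *g gam (dg g) >>.

Let psi0 : psi 0 = 0.
Proof. by apply: (addrI (psi 0)); rewrite -psiD !addr0. Qed.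

Let psi1 : psi 1 = << 1 *g 0 >>.
Proof. by rewrite -(@scal1 K B) psi_scal scal1. Qed.

Lemma psi_prod (s : seq Gen) : psi (\prod_(g <- s) h g) =
  << word_coef (fun a => sig (gam a)) dg cf s *g gam (word_degree dg s) >>.
Proof.
elim: s => [|g s IH]; first by rewrite big_nil psi1 /word_degree big_nil raddf0.
rewrite big_cons (psi_mulU (psi_h g) IH) /= /word_degree big_cons raddfD.
by [].
Qed.

(** Generators go to single terms $r T^k$, hence so do words; multiplicativity of [psi] on elements
    with such images is therefore enough. *)
Lemma psi_free_eval (f : free_alg K Gen) : psi (free_eval h f) =
  malg_push gam (skew_coef (fun a => sig (gam a)) dg cf f).
Proof.
rewrite /free_eval (big_morph psi psiD psi0) skew_coefE /malg_lift.
rewrite (big_morph (malg_push gam) (malg_liftD _) (malg_lift0 _)).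
apply: eq_bigr => w _; rewrite (psi_mulU (psi_scal _) (psi_prod w)) sig0 add0r.
by rewrite /malg_push malg_liftU.
Qed.
End Transport.

(** * The Weyl algebra inside a skew group ring, by $x_e \mapsto T^e$ and $y_e \mapsto u_e
    T^{-e}$ *)

Section WeylModel.
Variables (K : comNzRingType) (E : choiceType) (R : pzAlgType K) (u : E -> R).
Variable sig : {malg E} -> R -> R.
Hypotheses (sig_morph : forall k, alg_morphism (sig k))
  (sig0 : forall r, sig 0 r = r)
  (sigD : forall k l r, sig (k + l) r = sig k (sig l r))
  (sig_u : forall k e, sig k (u e) = u e - (k@_e)%:~R)
  (u_comm : forall e f, u e * u f = u f * u e).
Local Notation S := {malg R[{malg E}]}.
Local Notation W := (weyl K E).

Definition weyl_deg (g : E + E) : {malg E} :=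
  match g with inl e => << e >> | inr e => - << e >> end.
Definition weyl_gcoef (g : E + E) : R := match g with inl e => 1 | inr e => u e end.

Definition weyl_coef : weyl_free K E -> S := @skew_coef K R _ sig _ weyl_deg weyl_gcoef.

Let sig1 k : sig k 1 = 1.
Proof. by rewrite -(@scal1 K R); case: (sig_morph k) => -> _ _. Qed.

Local Notation xg e := (free_gen K (inl e : E + E) : weyl_free K E).
Local Notation yg e := (free_gen K (inr e : E + E) : weyl_free K E).

Let coef_x e : weyl_coef (xg e) = << 1 *g << e >> >>.
Proof. exact: skew_coef_gen. Qed.

Let coef_y e : weyl_coef (yg e) = << u e *g - << e >> >>.
Proof. exact: skew_coef_gen. Qed.

Let coef_mulU f g k r l s : weyl_coef f = << r *g k >> ->
  weyl_coef g = << s *g l >> -> weyl_coef (f * g) = << r * sig k s *g k + l >>.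
Proof.
move=> fE gE; apply: (eq_trans (skew_coefM sig_morph sig0 sigD _ _ _ _)).
rewrite -/(weyl_coef f) -/(weyl_coef g) fE gE; exact: skew_mulUU.
Qed.

Let coef_sub f g a b : weyl_coef f = a -> weyl_coef g = b -> weyl_coef (f - g) = a - b.
Proof. by move=> <- <-; exact: skew_coefB. Qed.

Let coef0 : weyl_coef 0 = 0. Proof. exact: skew_coef0. Qed.

(** For $y_e x_f - x_f y_e$ the image is $u_e - \sigma_f(u_e) = \delta_{ef}$ times $T^{f-e}$. The
    relations among the $y_e$ use that $\sigma_{-e}$ fixes $u_f$ for $f \neq e$. *)
Lemma weyl_coef_rel f g : weyl_rel f g -> weyl_coef f = weyl_coef g.
Proof.
case=> e e'.
- apply: (eq_trans (coef_sub (coef_mulU (coef_x e) (coef_x e'))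
                             (coef_mulU (coef_x e') (coef_x e)))).
  by rewrite !sig1 [<< e >> + _]addrC subrr coef0.
- apply: (eq_trans (coef_sub (coef_mulU (coef_y e) (coef_y e'))
                             (coef_mulU (coef_y e') (coef_y e)))).
  rewrite !sig_u !mcoeffN !mcoeffU [- << e >> - _]addrC coef0; apply/eqP.
  rewrite subr_eq0; apply/eqP; congr << _ *g _ >>.
  have [->//|_] := eqVneq e e'; rewrite oppr0 !addr0; exact: u_comm.
- apply: (eq_trans (coef_sub (coef_mulU (coef_y e) (coef_x e'))
                             (coef_mulU (coef_x e') (coef_y e)))).
  rewrite !sig1 sig_u mcoeffU mulr1 mul1r [- << e >> + _]addrC -monalgUB subKr.
  rewrite eq_sym; case: eqP => [->|_].
    rewrite subrr; apply: esym; apply: (eq_trans (skew_coef_scal _ _ _ 1)).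
    by rewrite scal1.
  by rewrite [X in << X *g _ >>](_ : _ = 0) // monalgU0 coef0.
Qed.

Definition weyl_psi (q : W) : S := weyl_coef (quot_repr q).

Lemma weyl_psi_pi f : weyl_psi (quot_pi _ f) = weyl_coef f.
Proof.
have /quot_pi_eq : quot_pi _ (quot_repr (quot_pi _ f : W)) = quot_pi _ f :> W.
  exact: quot_reprK.
move=> /(_ (skew_ker sig_morph sig0 sigD weyl_deg weyl_gcoef)) h.
apply/eqP; rewrite -subr_eq0; apply/eqP.
apply: (eq_trans (esym (coef_sub (erefl _) (erefl _)))).
apply: h => _ [[a b]] /= ab <-; apply: (eq_trans (coef_sub (erefl _) (erefl _))).
by rewrite (weyl_coef_rel ab) subrr.
Qed.

Lemma weyl_psiD : {morph weyl_psi : x y / x + y}.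
Proof.
move=> x y; rewrite -(quot_reprK x) -(quot_reprK y) -quot_piD !weyl_psi_pi.
exact: skew_coefD.
Qed.

Lemma weyl_psi_mulU a b k r l s : weyl_psi a = << r *g k >> ->
  weyl_psi b = << s *g l >> -> weyl_psi (a * b) = << r * sig k s *g k + l >>.
Proof.
move=> aE bE; rewrite -(quot_reprK a) -(quot_reprK b) -quot_piM weyl_psi_pi.
exact: (coef_mulU aE bE).
Qed.

Lemma weyl_psi_scal c : weyl_psi (scal c) = << scal c *g 0 >>.
Proof. apply: (eq_trans (weyl_psi_pi _)); exact: skew_coef_scal. Qed.

Lemma weyl_psi_x e : weyl_psi (weyl_x K e) = << 1 *g << e >> >>.
Proof. exact: (eq_trans (weyl_psi_pi _) (coef_x e)). Qed.

Lemma weyl_psi_y e : weyl_psi (weyl_y K e) = << u e *g - << e >> >>.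
Proof. exact: (eq_trans (weyl_psi_pi _) (coef_y e)). Qed.

Lemma weyl_psi1 : weyl_psi 1 = << 1 *g 0 >>.
Proof. by rewrite -(@scal1 K W) weyl_psi_scal scal1. Qed.

Lemma weyl_psi0 : weyl_psi 0 = 0.
Proof. by apply: (addrI (weyl_psi 0)); rewrite -weyl_psiD !addr0. Qed.

(** The coefficient $c$ in $z_e^{(p)} \mapsto c T^{pe}$: positive powers of $x_e$ contribute 1, and
    $y_e^{n+1}$ contributes $u_e (u_e + 1) \cdots (u_e + n)$. *)
Definition zpow_coef (e : E) (p : int) : R :=
  match p with Posz _ => 1 | Negz n => \prod_(i < n.+1) (u e + i%:R) end.

Definition z_coef (k : {malg E}) : R := \prod_(e <- msupp k) zpow_coef e k@_e.

Let sig_u_fix k e (n : nat) : k@_e = 0 -> sig k (u e + n%:R) = u e + n%:R.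
Proof.
move=> ke; case: (sig_morph k) => sC sD _.
by rewrite sD sig_u ke subr0 -(rmorph_nat (@scal K R)) sC.
Qed.

Lemma sig_zpow_coef_fix k e p : k@_e = 0 -> sig k (zpow_coef e p) = zpow_coef e p.
Proof.
move=> ke; case: p => n /=; first exact: sig1.
have [_ _ sM] := sig_morph k; rewrite (big_morph _ sM (sig1 k)).
by apply: eq_bigr => i _; exact: sig_u_fix.
Qed.

Lemma weyl_psi_zpow e p :
  weyl_psi (weyl_zpow K e p) = << zpow_coef e p *g << p *g e >> >>.
Proof.
case: p => n; rewrite /weyl_zpow /=.
  elim: n => [|n IH]; first by rewrite expr0 weyl_psi1 monalgU0.
  rewrite exprS (weyl_psi_mulU (weyl_psi_x e) IH) sig1 mulr1 -monalgUD.
  by congr << _ *g << _ *g e >> >>; lia.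
have -> : Negz n = - n.+1%:Z by lia.
elim: n.+1 => [|{}n IH]; first by rewrite big_ord0 expr0 weyl_psi1 monalgU0.
(* Multiplying by $y_e$ on the right moves $u_e$ across $T^{-ne}$, which makes it the new last
   factor $u_e + n$. *)
rewrite exprSr (weyl_psi_mulU IH (weyl_psi_y e)) big_ord_recr /= sig_u mcoeffUU.
rewrite -monalgUN -monalgUD rmorphN opprK.
have -> : - n%:Z - 1 = - n.+1%:Z by lia.
exact: erefl.
Qed.

(** Since the edges are distinct, the shift coming from one factor fixes the coefficients of all the
    others. *)
Lemma weyl_psi_prod_zpow (k : {malg E}) (s : seq E) : uniq s ->
  weyl_psi (\prod_(e <- s) weyl_zpow K e k@_e) =
  << \prod_(e <- s) zpow_coef e k@_e *g \sum_(e <- s) << k@_e *g e >> >>.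
Proof.
elim: s => [|e s IH] /=; first by rewrite !big_nil weyl_psi1.
move=> /andP[es /IH {}IH]; rewrite !big_cons (weyl_psi_mulU (weyl_psi_zpow e _) IH).
congr << _ * _ *g _ >>; have [_ _ sM] := sig_morph << k@_e *g e >>.
rewrite (big_morph _ sM (sig1 _)); apply: eq_big_seq => f fs.
apply: sig_zpow_coef_fix; rewrite mcoeffU; case: eqP => // ef.
by rewrite ef fs in es.
Qed.

Lemma weyl_psi_z k : weyl_psi (weyl_z K k) = << z_coef k *g k >>.
Proof.
apply: (eq_trans (weyl_psi_prod_zpow k (fset_uniq (msupp k)))).
by rewrite -monalgE.
Qed.

Lemma weyl_psi_poly_eval (p : poly_alg K E) :
  weyl_psi (poly_eval (fun e => weyl_y K e * weyl_x K e) p) = << poly_eval u p *g 0 >>.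
Proof.
pose deg0 q r := weyl_psi q = << r *g 0 >>.
have d0M q r q' r' : deg0 q r -> deg0 q' r' -> deg0 (q * q') (r * r').
  move=> qr qr'; apply: (eq_trans (weyl_psi_mulU qr qr')); rewrite sig0 addr0.
  exact: erefl.
have d0u e : deg0 (weyl_y K e * weyl_x K e) (u e).
  by rewrite /deg0 (weyl_psi_mulU (weyl_psi_y e) (weyl_psi_x e)) sig1 mulr1 addNr.
rewrite /poly_eval (big_morph _ weyl_psiD weyl_psi0) raddf_sum.
apply: eq_bigr => m _; apply: (d0M _ _ _ _ (weyl_psi_scal _)).
apply: (big_ind2 deg0 weyl_psi1 (fun _ _ _ _ => d0M _ _ _ _)) => e _.
elim: (m e) => [|n IH]; first exact: weyl_psi1.
rewrite !exprS; exact: (d0M _ _ _ _ (d0u e) IH).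
Qed.

Let Wxx (e f : E) : weyl_x K e * weyl_x K f = weyl_x K f * weyl_x K e.
Proof.
rewrite -!quot_piM; apply/quot_pi_eq => J; apply.
exists (xg e * xg f - xg f * xg e, 0); [exact: weyl_xx|exact: subr0].
Qed.

Let Wyy (e f : E) : weyl_y K e * weyl_y K f = weyl_y K f * weyl_y K e.
Proof.
rewrite -!quot_piM; apply/quot_pi_eq => J; apply.
exists (yg e * yg f - yg f * yg e, 0); [exact: weyl_yy|exact: subr0].
Qed.

Let Wyx (e f : E) : weyl_y K e * weyl_x K f = weyl_x K f * weyl_y K e + (e == f)%:R.
Proof.
have -> : (e == f)%:R = quot_pi _ (e == f)%:R :> W.
  by case: (e == f); [exact: erefl|exact: esym (quot_pi0 _)].
rewrite -!quot_piM -quot_piD; apply/quot_pi_eq => J; apply.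
exists (yg e * xg f - xg f * yg e, (e == f)%:R); first exact: weyl_yx.
by rewrite /= opprD addrA.
Qed.

(** The span contains 1 and is stable under left multiplication by scalars and generators, so words
    are absorbed from right to left. *)
Lemma weyl_spanned (q : W) : weyl_span (@weyl_x K E) (@weyl_y K E) q.
Proof.
rewrite -(quot_reprK q) (monalgE (quot_repr q)).
apply: (big_ind (fun f => weyl_span (@weyl_x K E) (@weyl_y K E) (quot_pi _ f : W))).
- by rewrite quot_pi0; exact: weyl_span0.
- move=> f g; rewrite quot_piD; exact: (weyl_spanD Wxx Wyy Wyx).
move=> w _; rewrite free_monomE quot_piM.
apply: (weyl_span_scal Wxx Wyy Wyx).
elim: (w : seq _) => [|g s IH].
  by rewrite big_nil; exact: (weyl_span1 Wxx Wyy Wyx).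
rewrite big_cons quot_piM; case: g => e.
  exact: (weyl_span_x Wxx Wyy Wyx).
exact: (weyl_span_y Wxx Wyy Wyx).
Qed.

Hypotheses (z_coef_regular : forall k p, p * z_coef k = 0 -> p = 0)
  (u_indep : forall p, poly_eval u p = 0 -> p = 0 :> poly_alg K E).

(** In an expansion $\sum_k r_k z^k$ the terms go to distinct degrees, so each $r_k c_k$ vanishes,
    and $c_k$ is regular. *)
Lemma weyl_psi_eq0 q : weyl_psi q = 0 -> q = 0.
Proof.
have [d [r [r0 qE]]] := weyl_spanned q; move=> q0.
suff rk k : r k = 0.
  rewrite qE big1 // => k _; rewrite rk.
  have [_ eD _] := weyl_ev_morphism Wxx Wyy Wyx.
  rewrite (_ : weyl_ev _ _ 0 = 0) ?mul0r //.
  by apply: (addrI (weyl_ev (@weyl_x K E) (@weyl_y K E) 0)); rewrite -eD !addr0.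
have [kd|/r0 //] := boolP (k \in d).
apply: u_indep; apply: (z_coef_regular (k := k)).
have := congr1 (mcoeff k) q0; rewrite mcoeff0 => <-.
have termE l : weyl_psi (weyl_ev (@weyl_x K E) (@weyl_y K E) (r l) *
    zmon (@weyl_x K E) (@weyl_y K E) l) = << poly_eval u (r l) * z_coef l *g l >>.
  apply: (eq_trans (weyl_psi_mulU (weyl_psi_poly_eval _) (weyl_psi_z l))).
  rewrite sig0 add0r; exact: erefl.
rewrite qE (big_morph _ weyl_psiD weyl_psi0) (eq_bigr _ (fun l _ => termE l)).
exact: esym (mcoeff_sumU _ kd).
Qed.

Lemma weyl_psi_inj : injective weyl_psi.
Proof.
move=> a b ab; apply/eqP; rewrite -subr_eq0; apply/eqP/weyl_psi_eq0.
by apply: (addIr (weyl_psi b)); rewrite -weyl_psiD subrK ab add0r.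
Qed.
End WeylModel.

(** * The algebra of a multiquiver *)

Lemma mulr_sub_eq (R : pzRingType) (p a z : R) : p * a = p * (a - z) -> p * z = 0.
Proof.
by move=> h; apply: (addIr (p * (a - z))); rewrite -mulrDr addrC subrK add0r.
Qed.

(** * Products of consecutive shifts *)

Section ShiftedPowers.
Variable R : comNzRingType.
Implicit Types (x : R) (p q : int).

Definition zpow_at x p : R :=
  match p with Posz _ => 1 | Negz n => \prod_(i < n.+1) (x + i%:R) end.

(** This is the contribution of one edge to $Y_v X_v = t_v$: the right-hand side is the expression
    defining [mq_u], and one of the two factors on the left is always 1. *)
Lemma zpow_at_opp x p : zpow_at x (- p) * zpow_at (x + p%:~R) p =
  match p with
  | Posz n => \prod_(0 <= i < n) (x + i%:R)
  | Negz n => \prod_(1 <= i < n.+2) (x - i%:R)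
  end.
Proof.
case: p => [[|n]|n].
- by rewrite big_geq // mulr1.
- by rewrite /= mulr1 big_mkord.
rewrite NegzE opprK mul1r rmorphN -NegzE /= big_add1 /= big_mkord.
(* The factors $x - (n+1) + i$ are the $x - j$ in reverse order. *)
rewrite (reindex_inj rev_ord_inj) /=; apply: eq_bigr => i _.
rewrite -addrA; congr (_ + _); rewrite subSS natrB ?leq_ord // addrCA.
have -> : n.+1%:~R = n%:R + 1 :> R by rewrite -pmulrn -natr1.
have -> : i.+1%:R = i%:R + 1 :> R by rewrite -natr1.
ring.
Qed.

(** For two negative exponents both sides are the same run of consecutive factors starting at [x].
    Strictly opposite signs are excluded, and the remaining cases are trivial. *)
Lemma zpow_atC x p q : 0 <= p * q ->
  zpow_at x p * zpow_at (x - p%:~R) q = zpow_at x q * zpow_at (x - q%:~R) p.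
Proof.
have split m n : zpow_at x (Negz m) * zpow_at (x - (Negz m)%:~R) (Negz n) =
    \prod_(i < m.+1 + n.+1) (x + i%:R).
  rewrite big_split_ord /=; congr (_ * _); apply: eq_bigr => i _.
  by rewrite NegzE rmorphN opprK natrD addrA.
case: p => [m|m]; case: q => [n|n] //= pq.
- have -> : m = 0%N by lia.
  by rewrite subr0 mul1r mulr1.
- have -> : n = 0%N by lia.
  by rewrite subr0 mul1r mulr1.
- by rewrite !split addnC.
Qed.
End ShiftedPowers.

(** * The incidence matrix as an additive map *)

Section GammaTheory.
Variables (V E : choiceType) (Gam : multiquiver V E).

Lemma mem_edges_at v e : (e \in edges_at Gam v) = incident Gam v e.
Proof.
rewrite /edges_at in_fset_set; last exact: locally_finite.
by apply/idP/idP; rewrite in_setE.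
Qed.

Lemma gamma_coef_eq0 v e : ~~ incident Gam v e -> gamma_coef Gam e v = 0.
Proof.
by rewrite /incident /gamma_coef negb_or => /andP[/negbTE -> /negbTE ->].
Qed.

(** An edge has at most one source and one target, so it cannot enter, or leave, two distinct
    vertices. This sign condition is what makes $X_v$ and $Y_w$ commute. *)
Lemma gamma_coef_sign e v w : v != w -> gamma_coef Gam e v * gamma_coef Gam e w <= 0.
Proof.
move=> vw; rewrite /gamma_coef /has_vertex.
case: (tgt Gam e) => [[a m]|] /=; case: (src Gam e) => [[b n]|] /=;
  rewrite ?mul0r ?mulr0 ?(inj_eq Some_inj) //.
- have [av|_] := eqVneq a v; have [aw|_] := eqVneq a w;
    have [bv|_] := eqVneq b v; have [bw|_] := eqVneq b w; rewrite ?mulr0 ?mul0r //;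
    solve [nia | by rewrite -?av -?aw -?bv -?bw eqxx in vw].
- have [av|_] := eqVneq a v; have [aw|_] := eqVneq a w; rewrite ?mulr0 ?mul0r //.
  by rewrite -av aw eqxx in vw.
- have [bv|_] := eqVneq b v; have [bw|_] := eqVneq b w; rewrite ?mulr0 ?mul0r //.
  by rewrite -bv bw eqxx in vw.
Qed.

Definition gammaU (v : V) (c : int) : {malg E} :=
  \sum_(e <- edges_at Gam v) << c * gamma_coef Gam e v *g e >>.

Fact gammaU_additive v : {morph gammaU v : x y / x - y}.
Proof.
move=> x y; rewrite /gammaU -sumrB; apply: eq_bigr => e _.
by rewrite mulrBl monalgUB.
Qed.

HB.instance Definition _ v :=
  GRing.isZmodMorphism.Build int {malg E} (gammaU v) (gammaU_additive v).

Lemma gammaE a : gamma Gam a = malg_lift gammaU a.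
Proof. by []. Qed.

Fact gamma_additive : {morph gamma Gam : x y / x - y}.
Proof. by move=> x y; rewrite !gammaE malg_lift_is_additive. Qed.

HB.instance Definition _ :=
  GRing.isZmodMorphism.Build {malg V} {malg E} (gamma Gam) gamma_additive.

Lemma gammaU_coef v c e : (gammaU v c)@_e = c * gamma_coef Gam e v.
Proof.
rewrite /gammaU raddf_sum /=; have [ve|ve] := boolP (e \in edges_at Gam v).
  rewrite (big_fsetD1 e ve) /= mcoeffUU big1_fset ?addr0 // => f.
  by rewrite in_fsetD1 => /andP[fe _] _; rewrite mcoeffU (negbTE fe).
rewrite gamma_coef_eq0 -?mem_edges_at // mulr0 big1_seq // => f /= fv.
by rewrite mcoeffU; case: eqP => // fe; rewrite -fe fv in ve.
Qed.

Lemma gamma1_coef v e : (gamma Gam << v >>)@_e = gamma_coef Gam e v.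
Proof. by rewrite gammaE malg_liftU gammaU_coef mul1r. Qed.

Lemma gamma_coefE a e : (gamma Gam a)@_e = \sum_(v <- msupp a) a@_v * gamma_coef Gam e v.
Proof.
rewrite gammaE /malg_lift raddf_sum /=; apply: eq_bigr => v _; exact: gammaU_coef.
Qed.
End GammaTheory.

(** * The algebra $\mathcal{A}(\Gamma)$, its canonical representation, and the centralizer of
    $R_E$ *)

Section MultiquiverAlgebra.
Variables (K : fieldType) (charK : [pchar K] =i pred0).
Variables (V E : choiceType) (Gam : multiquiver V E).
Local Notation R := (poly_alg K E).
Local Notation u := (@poly_var K E).
Local Notation zc := (@z_coef K E R u).

Lemma shift_morphism k : alg_morphism (shift k : R -> R).
Proof. by split; [exact: shiftC|exact: shift_add|exact: shift_mul]. Qed.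

Lemma zpow_coefE e p : zpow_coef u e p = zpow_at (u e) p.
Proof. by case: p. Qed.

Lemma shift_zpow_coef k e p :
  shift k (zpow_coef u e p) = zpow_at (u e - (k@_e)%:~R) p.
Proof.
rewrite zpow_coefE; case: p => n; first exact: rmorph1.
rewrite /zpow_at rmorph_prod; apply: eq_bigr => i _.
by rewrite /= shift_add shift_u rmorph_nat.
Qed.

Lemma z_coefEw (d : {fset E}) k : (msupp k `<=` d)%fset ->
  zc k = \prod_(e <- d) zpow_coef u e k@_e.
Proof.
move=> kd; rewrite /z_coef (big_fset_incl _ kd) // => e _ /mcoeff_outdom ->.
exact: erefl.
Qed.

(** The left-hand side is the coefficient of $z^k z^l$; as shifts act on each variable separately,
    it splits into factors indexed by edges. *)
Lemma z_coef_mul_shift (d : {fset E}) k l : (msupp k `<=` d)%fset -> (msupp l `<=` d)%fset ->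
  zc k * shift k (zc l) =
  \prod_(e <- d) (zpow_at (u e) k@_e * zpow_at (u e - (k@_e)%:~R) l@_e).
Proof.
move=> kd ld; rewrite (z_coefEw kd) (z_coefEw ld) rmorph_prod big_split /=.
congr (_ * _); apply: eq_bigr => e _; exact: shift_zpow_coef.
Qed.

Lemma regular_zpow_coef e p : regular (zpow_coef u e p).
Proof.
case: p => n; first exact: regular1.
by apply: regular_prod => i _; exact: (@regular_var_addz K E e i).
Qed.

Lemma regular_z_coef k : regular (zc k).
Proof. by apply: regular_prod => e _; exact: regular_zpow_coef. Qed.

Definition mq_cX v : R := zc (gamma Gam << v >>).
Definition mq_cY v : R := zc (- gamma Gam << v >>).
Definition mq_sig (a : {malg V}) : R -> R := shift (gamma Gam a).

Lemma mq_sigE v r : mq_sig << v >> r = mq_sigma Gam v r.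
Proof.
rewrite /mq_sig /mq_sigma shiftE; congr (poly_eval _ r); apply/funext => e.
by rewrite /shift_var gamma1_coef.
Qed.

Lemma mq_sig_morphism a : alg_morphism (mq_sig a).
Proof. exact: shift_morphism. Qed.

Lemma mq_sig0 r : mq_sig 0 r = r.
Proof. by rewrite /mq_sig raddf0 shift0. Qed.

Lemma mq_sigD a b r : mq_sig (a + b) r = mq_sig a (mq_sig b r).
Proof. by rewrite /mq_sig raddfD shiftD. Qed.

Let supp1 v : (msupp (gamma Gam << v >>) `<=` edges_at Gam v)%fset.
Proof.
apply/fsubsetP => e; rewrite -mcoeff_neq0 gamma1_coef mem_edges_at.
by apply: contraNT => /gamma_coef_eq0 ->.
Qed.

Lemma mq_c_YX v : mq_cY v * mq_sig (- << v >>) (mq_cX v) = mq_t K Gam v.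
Proof.
rewrite /mq_cY /mq_cX /mq_sig raddfN (z_coef_mul_shift (d := edges_at Gam v)) ?msuppN //.
rewrite /mq_t; apply: eq_bigr => e _.
rewrite mcoeffN gamma1_coef rmorphN opprK; exact: zpow_at_opp.
Qed.

Lemma mq_c_XY v : mq_cX v * mq_sig << v >> (mq_cY v) = mq_sigma Gam v (mq_t K Gam v).
Proof.
rewrite -mq_sigE -mq_c_YX; have [_ _ sM] := mq_sig_morphism << v >>.
by rewrite sM -mq_sigD subrr mq_sig0 mulrC.
Qed.

(** Edge by edge this is [zpow_atC] for the exponents $\gamma_{ev}$ and $-\gamma_{ew}$, whose
    product is nonnegative. *)
Lemma mq_c_XYC v w : v != w -> mq_cX v * mq_sig << v >> (mq_cY w) =
  scal 1 * (mq_cY w * mq_sig (- << w >>) (mq_cX v)).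
Proof.
move=> vw; rewrite scal1 mul1r /mq_cX /mq_cY /mq_sig raddfN.
pose d := (edges_at Gam v `|` edges_at Gam w)%fset.
have vd : (msupp (gamma Gam << v >>) `<=` d)%fset.
  exact: fsubset_trans (supp1 v) (fsubsetUl _ _).
have wd : (msupp (- gamma Gam << w >>) `<=` d)%fset.
  by rewrite msuppN; exact: fsubset_trans (supp1 w) (fsubsetUr _ _).
rewrite (z_coef_mul_shift vd wd) (z_coef_mul_shift wd vd); apply: eq_bigr => e _.
apply: zpow_atC; rewrite mcoeffN !gamma1_coef mulrN oppr_ge0.
exact: gamma_coef_sign.
Qed.

Local Notation D := (mq_datum charK Gam).
Local Notation mu := (fun _ _ : V => 1 : K).
Local Notation of_free := (@tgw_of_free K R V D mu).

Definition mq_coef : tgw_free R V -> {malg R[{malg V}]} := tgw_coef mq_cX mq_cY mq_sig.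

Let cXc v r : mq_cX v * r = r * mq_cX v. Proof. exact: mulrC. Qed.
Let cYc v r : mq_cY v * r = r * mq_cY v. Proof. exact: mulrC. Qed.
Let cXr v p : mq_cX v * p = 0 -> p = 0. Proof. exact: regular_z_coef. Qed.
Let cYr v p : mq_cY v * p = 0 -> p = 0. Proof. exact: regular_z_coef. Qed.
Let mu1 (v w : V) : (1 : K) * 1 = 1. Proof. exact: mulr1. Qed.

Lemma mq_of_free_eq f g : of_free f = of_free g <-> mq_coef f = mq_coef g.
Proof.
exact: (@tgw_of_free_eq K R V D mu mu mq_cX mq_cY mq_sig mq_sig_morphism mq_sig0
  mq_sigD mq_sigE mu1 cXc cYc cXr cYr mq_c_YX mq_c_XY mq_c_XYC).
Qed.

Lemma mq_exists_regular_word d : exists f r,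
  regular r /\ mq_coef f = << r *g d >>.
Proof.
have [s [sd sr]] := exists_regular_word mq_sig_morphism mq_sig0 mq_sigD cXr cYr d.
exists (word s), (word_coef mq_sig (@gen_deg K R V) (gen_coef mq_cX mq_cY) s).
by split; [exact: sr|rewrite -sd; exact: tgw_coef_word].
Qed.

Lemma mq_coef_rgen r : mq_coef (rgen V r) = << r *g 0 >>.
Proof. exact: (tgw_coef_rgen _ _ mq_sig_morphism). Qed.

Lemma mq_coefM f g : mq_coef (f * g) = skew_mul mq_sig_morphism (mq_coef f) (mq_coef g).
Proof. exact: (tgw_coefM _ _ mq_sig_morphism mq_sig0 mq_sigD). Qed.

Lemma mq_coef_mulU f g k r l s : mq_coef f = << r *g k >> ->
  mq_coef g = << s *g l >> -> mq_coef (f * g) = << r * mq_sig k s *g k + l >>.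
Proof. exact: (tgw_coef_mulU mq_sig_morphism mq_sig0 mq_sigD). Qed.

Lemma mq_coefMr f s b : (mq_coef (f * rgen V s))@_b = (mq_coef f)@_b * mq_sig b s.
Proof.
apply: (eq_trans (congr1 (mcoeff b) (mq_coefM _ _))); rewrite mq_coef_rgen.
exact: skew_mulU0_coef.
Qed.

Lemma mq_coefMl f s b : (mq_coef (rgen V s * f))@_b = s * (mq_coef f)@_b.
Proof.
apply: (eq_trans (congr1 (mcoeff b) (mq_coefM _ _))); rewrite mq_coef_rgen.
have := skew_mulUl_coef mq_sig_morphism 0 s (mq_coef f) b; rewrite add0r mq_sig0; exact.
Qed.

Lemma mq_coefD f g : mq_coef (f + g) = mq_coef f + mq_coef g.
Proof. exact: tgw_coefD. Qed.

Lemma mq_of_free_repr (a : mq_tgw charK Gam) : of_free (quot_repr (quot_repr a)) = a.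
Proof. by rewrite /tgw_of_free !quot_reprK. Qed.

Let psi := @weyl_psi K E R u (@shift K E).

Lemma poly_eval_u (p : R) : poly_eval u p = p.
Proof. exact: poly_eval_id. Qed.

Let u_comm e f : u e * u f = u f * u e. Proof. exact: mulrC. Qed.

Lemma mq_psi_inj : injective psi.
Proof.
apply: (weyl_psi_inj shift_morphism (@shift0 K E) (@shiftD K E) (@shift_u K E) u_comm).
  by move=> k p; rewrite mulrC; exact: regular_z_coef.
by move=> p; rewrite poly_eval_u.
Qed.

(** Read in the two skew group rings, the canonical representation is the pushforward along [gamma];
    by [psi_free_eval] it suffices to compare generators. *)
Lemma mq_psi_canonical_rep a :
  psi (canonical_rep charK Gam a) = malg_push (gamma Gam) (mq_coef (quot_repr (quot_repr a))).
Proof.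
apply: (@psi_free_eval K R (weyl K E) {malg V} {malg E} (gamma Gam) (@shift K E) psi).
- exact: (weyl_psiD shift_morphism (@shift0 K E) (@shiftD K E) (@shift_u K E) u_comm).
- exact: (weyl_psi_scal shift_morphism (@shift0 K E) (@shiftD K E) (@shift_u K E) u_comm).
- exact: (weyl_psi_mulU shift_morphism (@shift0 K E) (@shiftD K E) (@shift_u K E) u_comm).
- exact: shift0.
case=> [[r|v]|v] /=.
- rewrite raddf0; apply: (eq_trans (weyl_psi_poly_eval shift_morphism (@shift0 K E)
    (@shiftD K E) (@shift_u K E) u_comm r)).
  by rewrite poly_eval_u.
- exact: (weyl_psi_z shift_morphism (@shift0 K E) (@shiftD K E) (@shift_u K E) u_comm).
- rewrite raddfN.
  exact: (weyl_psi_z shift_morphism (@shift0 K E) (@shiftD K E) (@shift_u K E) u_comm).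
Qed.

Lemma of_freeM f g : of_free (f * g) = of_free f * of_free g.
Proof. by rewrite /tgw_of_free !quot_piM. Qed.

Lemma of_freeD f g : of_free (f + g) = of_free f + of_free g.
Proof. by rewrite /tgw_of_free !quot_piD. Qed.

Lemma mq_coef_repr f :
  mq_coef (quot_repr (quot_repr (of_free f : mq_tgw charK Gam))) = mq_coef f.
Proof. by apply/mq_of_free_eq; exact: mq_of_free_repr. Qed.

Lemma canonical_rep_inj : injective (gamma Gam) -> injective (canonical_rep charK Gam).
Proof.
move=> gam_inj a b ab; rewrite -(mq_of_free_repr a) -(mq_of_free_repr b).
apply/mq_of_free_eq/(malg_push_inj gam_inj); rewrite -!mq_psi_canonical_rep.
by rewrite ab.
Qed.

Lemma gamma_injP : injective (gamma Gam) <-> forall a, gamma Gam a = 0 -> a = 0.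
Proof.
split=> [gi a a0|g0 a b ab]; first by apply: gi; rewrite a0 raddf0.
by apply/eqP; rewrite -subr_eq0; apply/eqP/g0; rewrite raddfB /= ab subrr.
Qed.

Lemma psi_canonical_of_free f r a : mq_coef f = << r *g a >> ->
  psi (canonical_rep charK Gam (of_free f)) = << r *g gamma Gam a >>.
Proof.
move=> fr; apply: (eq_trans (mq_psi_canonical_rep _)).
rewrite mq_coef_repr fr; exact: malg_pushE.
Qed.

(* If [gamma a = 0], a word of degree [a] with coefficient [r] and [r] itself
   have the same image in the Weyl algebra. *)
Lemma gamma_inj_of_canonical_rep :
  injective (canonical_rep charK Gam) -> injective (gamma Gam).
Proof.
move=> cinj; apply/gamma_injP => a a0.
have [f [r [rr fr]]] := mq_exists_regular_word a.
apply: (malgU_inj (s := r) (b := 0) (regular_neq0 rr)).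
rewrite -fr -mq_coef_rgen; apply/mq_of_free_eq; apply: cinj; apply: mq_psi_inj.
apply: (eq_trans (psi_canonical_of_free fr)); apply: esym.
apply: (eq_trans (psi_canonical_of_free (mq_coef_rgen r))).
rewrite raddf0 a0; exact: erefl.
Qed.

Lemma mq_R_comm_subalgebra : comm_subalgebra (mq_R charK Gam).
Proof.
have rE (r : R) f : mq_coef f = << r *g 0 >> -> of_free f = of_free (rgen V r).
  move=> fr; apply/mq_of_free_eq; exact: (eq_trans fr (esym (mq_coef_rgen r))).
split; first split.
- move=> c; apply: (ex_intro2 _ _ (scal c) I); rewrite /tgw_r.
  apply/esym/(rE (scal c) (scal c)); exact: tgw_coef_scal.
- move=> _ _ [r _ <-] [s _ <-]; apply: (ex_intro2 _ _ (r + s) I); rewrite /tgw_r -of_freeD.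
  apply/esym/rE; apply: (eq_trans (mq_coefD _ _)); rewrite monalgUD.
  exact: (congr2 _ (mq_coef_rgen r) (mq_coef_rgen s)).
- move=> _ _ [r _ <-] [s _ <-]; apply: (ex_intro2 _ _ (r * s) I); rewrite /tgw_r -of_freeM.
  apply/esym/rE; apply: (eq_trans (mq_coef_mulU (mq_coef_rgen r) (mq_coef_rgen s))).
  rewrite mq_sig0 addr0; exact: erefl.
move=> _ _ [r _ <-] [s _ <-]; rewrite /tgw_r -!of_freeM; apply/mq_of_free_eq.
apply: (eq_trans (mq_coef_mulU (mq_coef_rgen r) (mq_coef_rgen s))); apply: esym.
apply: (eq_trans (mq_coef_mulU (mq_coef_rgen s) (mq_coef_rgen r))).
rewrite !mq_sig0 [s * r]mulrC; exact: erefl.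
Qed.

(** In characteristic zero a nonzero integer is invertible in [K]. *)
Lemma intr_regular (z : int) (p : R) : z != 0 -> p * z%:~R = 0 -> p = 0.
Proof.
move=> z0 pz; have zK : (z%:~R : K) != 0.
  case: z z0 {pz} => n n0.
    by rewrite -pmulrn; move: n0; case: n => // n _; rewrite ((pcharf0P K).1 charK).
  by rewrite NegzE rmorphN /= oppr_eq0 -pmulrn ((pcharf0P K).1 charK).
rewrite -(mulr1 p) -(@scal1 K R) -(divff zK) scalM mulrA.
have -> : scal (z%:~R : K) = z%:~R :> R by exact: rmorph_int.
by rewrite pz mul0r.
Qed.

Lemma mq_R_max_comm : injective (gamma Gam) -> max_comm_subalgebra (mq_R charK Gam).
Proof.
move=> /gamma_injP gi; apply: centralizer_max_comm_subalgebra.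
  exact: mq_R_comm_subalgebra.
move=> a aR; have [f fa] : exists f, of_free f = a by eexists; exact: mq_of_free_repr.
have fu e : mq_coef (f * rgen V (u e)) = mq_coef (rgen V (u e) * f).
  apply/mq_of_free_eq; apply: (eq_trans (of_freeM f _)); rewrite fa.
  apply: (eq_trans (aR (of_free (rgen V (u e))) (ex_intro2 _ _ (u e) I erefl))).
  rewrite -fa; exact: esym (of_freeM _ _).
(* Commuting with [u e] gives $c_b (u_e - \gamma(b)_e) = u_e c_b$ for the coefficient $c_b$, so $c_b
   \neq 0$ forces $\gamma(b)_e = 0$ for every $e$. *)
have f0 b : (mq_coef f)@_b != 0 -> b = 0.
  move=> fb; apply: gi; apply/malgP => e; rewrite mcoeff0.
  have h : (mq_coef f)@_b * mq_sig b (u e) = u e * (mq_coef f)@_b.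
    apply: (eq_trans (esym (mq_coefMr f (u e) b))); rewrite fu; exact: mq_coefMl.
  apply/eqP; apply: contraNT fb => ge0; apply/eqP; apply: (intr_regular ge0).
  apply: (mulr_sub_eq (a := u e)); apply: (eq_trans (mulrC _ _)).
  apply: (eq_trans (esym h)).
  rewrite /mq_sig shift_u; exact: erefl.
rewrite -fa; apply: (ex_intro2 _ _ (mq_coef f)@_0 I); apply/mq_of_free_eq; rewrite mq_coef_rgen.
apply/malgP => b; rewrite mcoeffU; case: eqP => [<- //|b0].
by apply/esym/eqP; apply/negPn/negP => /f0 /esym.
Qed.

(** If $\gamma(a) = 0$, an element of degree $a$ commutes with $R_E$, so by maximality it lies in
    $R_E$; a regular coefficient is nonzero, which forces $a = 0$. *)
Lemma gamma_inj_of_mq_R_max_comm :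
  max_comm_subalgebra (mq_R charK Gam) -> injective (gamma Gam).
Proof.
move=> Rmax; apply/gamma_injP => a a0.
have [f [r [rr fr]]] := mq_exists_regular_word a.
have [s _ sf] : mq_R charK Gam (of_free f).
  apply: (max_comm_subalgebra_centralizer Rmax) => _ [s _ <-].
  rewrite /tgw_r -!of_freeM; apply/mq_of_free_eq.
  apply: (eq_trans (mq_coef_mulU fr (mq_coef_rgen s))); apply: esym.
  apply: (eq_trans (mq_coef_mulU (mq_coef_rgen s) fr)).
  rewrite mq_sig0 /mq_sig a0 shift0 addr0 add0r [s * r]mulrC; exact: erefl.
apply: (malgU_inj (s := s) (b := 0) (regular_neq0 rr)); rewrite -fr -mq_coef_rgen.
by apply/mq_of_free_eq; rewrite -sf.
Qed.
End MultiquiverAlgebra.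

(** * The kernel of the incidence matrix *)

Lemma inj_surj_bijective (A B : Type) (f : A -> B) :
  injective f -> (forall b, exists a, f a = b) -> bijective f.
Proof.
move=> f_inj f_surj; have g b := cid (f_surj b).
exists (fun b => sval (g b)) => [a|b]; last exact: (svalP (g b)).
by apply: f_inj; exact: (svalP (g (f a))).
Qed.

Section Potentials.
Variables (V E : choiceType) (Gam : multiquiver V E).

Definition end_val (F : pzSemiRingType) (a : V -> F) (x : option (V * nat)) : F :=
  if x is Some (v, n) then a v * n%:R else 0.

(** The kernel condition on edges with two ends, over an arbitrary semiring so that integral and
    rational solutions are treated alike. *)
Definition potential (F : pzSemiRingType) (a : V -> F) : Prop :=
  forall e u m v n, src Gam e = Some (u, m) -> tgt Gam e = Some (v, n) ->
    a u * m%:R = a v * n%:R.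
End Potentials.

(** The test order in [gamma_coef] is harmless: without loops, source and target of an edge are
    never the same vertex. *)
Lemma gamma_end_val (V E : choiceType) (Gam : multiquiver V E) (a : {malg V}) e :
  (gamma Gam a)@_e = end_val (mcoeff^~ a) (tgt Gam e) - end_val (mcoeff^~ a) (src Gam e).
Proof.
have sumE (x : option (V * nat)) :
    \sum_(v <- msupp a) a@_v * (if has_vertex x v then (multiplicity x)%:Z else 0) =
    end_val (mcoeff^~ a) x.
  case: x => [[w n]|] /=; last by rewrite big1 // => v _; rewrite mulr0.
  rewrite /multiplicity /= /has_vertex /=.
  have [wa|wa] := boolP (w \in msupp a).
    rewrite (big_fsetD1 w wa) /= eqxx big1_fset ?addr0 ?natz // => v.
    rewrite in_fsetD1 => /andP[vw _] _; case: eqP => [[wv]|_]; last exact: mulr0.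
    by rewrite wv eqxx in vw.
  rewrite big1_seq ?(mcoeff_outdom wa) ?mul0r // => v /= va.
  case: eqP => [[wv]|_]; last exact: mulr0.
  by rewrite wv va in wa.
rewrite gamma_coefE -!sumE -sumrB; apply: eq_bigr => v _; rewrite -mulrBr.
congr (_ * _); rewrite /gamma_coef /has_vertex.
case Et : (tgt Gam e) => [[w n]|] /=; case Es : (src Gam e) => [[w' n']|] /=;
  rewrite ?subr0 ?sub0r //.
- case: eqP => [[wv]|_]; case: eqP => [[wv']|_]; rewrite ?subr0 ?sub0r ?oppr0 //.
  by have := no_loops Es Et; rewrite wv wv' eqxx.
- by case: eqP; rewrite ?oppr0.
Qed.

Section Transfer.
Variables (F : pzSemiRingType).

(** The equation attached to an edge is symmetric in its two ends. *)
Lemma potential_reverse (V E : choiceType) (Gam : multiquiver V E) r (a : V -> F) :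
  potential (reverse_edges Gam r) a <-> potential Gam a.
Proof.
split=> pa e u m v n /= su tv.
  have := pa e; rewrite /=; case: ifP => _ /= pe; last exact: pe su tv.
  exact: esym (pe _ _ _ _ tv su).
by move: su tv; case: ifP => _ su tv; [exact/esym/(pa e)|exact: (pa e)].
Qed.

Lemma potential_iso (V E V' E' : choiceType) (Gam : multiquiver V E)
    (Gam' : multiquiver V' E') (f : V -> V') (g : E -> E') (a : V' -> F) :
  (forall e, src Gam' (g e) = omap (fun vn => (f vn.1, vn.2)) (src Gam e)) ->
  (forall e, tgt Gam' (g e) = omap (fun vn => (f vn.1, vn.2)) (tgt Gam e)) ->
  potential Gam' a -> potential Gam (a \o f).
Proof.
move=> fs ft pa e u m v n su tv; apply: (pa (g e)).
  by rewrite fs su.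
by rewrite ft tv.
Qed.

Lemma potential_subgraph (V E : choiceType) (Gam : multiquiver V E)
    (V' : set V) (E' : set E) (a : V -> F) :
  potential Gam a -> potential (subgraph Gam V' E') (fun v : V' => a (val v)).
Proof. by move=> pa e u m v n /restrict_endP su /restrict_endP tv; exact: pa su tv. Qed.

End Transfer.

Lemma big_ordS_shift (F : comPzSemiRingType) n (f : 'I_n -> F) :
  \prod_i f (ordS i) = \prod_i f i.
Proof. by rewrite [RHS](reindex (@ordS n)) //; apply: onW_bij; exact: ordS_bij. Qed.

(** On the directed form of the cycle, multiply the equations $a(v_i) n_i = a(v_{i+1}) m_i$; both
    sides contain the product of all values of $a$, which is nonzero and cancels. *)
Lemma potential_balanced (V E : choiceType) (Gam : multiquiver V E) (a : V -> rat) :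
  (forall v, a v != 0) -> potential Gam a -> nnd_cycle Gam -> balanced_nnd_cycle Gam.
Proof.
move=> a0 pa [V' [E' [Gam' [[n [v [e [out [inn cyc]]]]] [r iso]]]]].
exists V', E', Gam'; split; last by exists r.
exists n, v, e, out, inn; split=> //; have [n0 vb eb es et] := cyc.
have [f [g [[f' fK f'K] [g' gK g'K] fs ft]]] := iso.
have step i : a (f' (v i)) * (out i)%:R = a (f' (v (ordS i))) * (inn i)%:R.
  have pr : potential (reverse_edges Gam r) a by apply/potential_reverse.
  have inv x w k : Some (w, k) = omap (fun vn => (f vn.1, vn.2)) x -> x = Some (f' w, k).
    by case: x => [[y l]|] //= [-> ->]; rewrite fK.
  apply: (pr (g' (e i))); apply: inv.
    by rewrite -fs g'K es.
  by rewrite -ft g'K et.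
have : \prod_i (a (f' (v i)) * (out i)%:R) = \prod_i (a (f' (v (ordS i))) * (inn i)%:R).
  by apply: eq_bigr => i _; exact: step.
rewrite !big_split /= (big_ordS_shift (fun i => a (f' (v i)))) => /mulfI h.
have := h _; rewrite -!natr_prod => /(_ _)/eqP; rewrite eqr_nat => h'.
by apply/eqP/h'; apply/prodf_neq0 => i _.
Qed.

(** Take for value at $v_k$ the partial product of the ratios $n_j / m_j$ over $j < k$; balance says
    that the full product is 1, which is the equation at the edge closing the cycle. *)
Lemma cycle_potential (V E : choiceType) (Gam : multiquiver V E) :
  balanced_directed_cycle Gam ->
  exists2 a : V -> rat, (forall v, a v != 0) & potential Gam a.
Proof.
move=> [n [v [e [out [inn [[n0 [v' vK v'K] [e' eK e'K] es et] bal]]]]]].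
have out0 i : (out i)%:R != 0 :> rat by rewrite pnatr_eq0 -lt0n; exact: src_gt0 (es i).
have inn0 i : (inn i)%:R != 0 :> rat by rewrite pnatr_eq0 -lt0n; exact: tgt_gt0 (et i).
pose c (k : nat) : rat := \prod_(j < n | (j < k)%N) ((out j)%:R / (inn j)%:R).
exists (fun w => c (v' w)).
  by move=> w; apply/prodf_neq0 => j _; rewrite mulf_neq0 ?invr_neq0.
have cS (i : 'I_n) : c i * (out i)%:R = c i.+1 * (inn i)%:R.
  rewrite /c [in RHS](bigD1 i) //= -mulrA mulrC mulrAC -!mulrA.
  rewrite divff // mulr1; congr (_ * _); apply: eq_bigl => j.
  by rewrite ltnS ltn_neqAle andbC.
have cn : c n = 1.
  rewrite /c (eq_bigl xpredT) => [|j]; last exact: ltn_ord.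
  rewrite prodf_div -!natr_prod bal divff // pnatr_eq0 -lt0n.
  by apply: prodn_gt0 => i; exact: tgt_gt0 (et i).
have c0 : c 0%N = 1 by rewrite /c big_pred0.
move=> e0 u m w k su tw; rewrite -(e'K e0) es in su; rewrite -(e'K e0) et in tw.
case: su => <- <-; case: tw => <- <-; rewrite !vK cS; congr (_ * _).
rewrite /=; set i := e' e0; have [iltn|] := ltnP i.+1 n; first by rewrite modn_small.
move=> ni; have -> : i.+1 = n by apply/eqP; rewrite eqn_leq ni ltn_ord.
by rewrite modnn cn c0.
Qed.

(** * Walks, their ratios, and potentials on balanced multiquivers *)

Section Walks.
Variables (V E : choiceType) (Gam : multiquiver V E).

(* An edge with a direction of travel; [true] means from target to source. *)
Definition dart := (E * bool)%type.
Definition dsrc (d : dart) := if d.2 then tgt Gam d.1 else src Gam d.1.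
Definition dtgt (d : dart) := if d.2 then src Gam d.1 else tgt Gam d.1.
Definition dflip (d : dart) : dart := (d.1, ~~ d.2).

(** The factor by which a potential changes along the dart. *)
Definition dratio (d : dart) : rat :=
  (multiplicity (dsrc d))%:R / (multiplicity (dtgt d))%:R.

Fixpoint walk (u : V) (s : seq dart) (w : V) : Prop :=
  if s is d :: s' then
    exists m v n, [/\ dsrc d = Some (u, m), dtgt d = Some (v, n) & walk v s' w]
  else u = w.

Definition ratio (s : seq dart) : rat := \prod_(d <- s) dratio d.

Lemma dsrc_gt0 d v n : dsrc d = Some (v, n) -> (0 < n)%N.
Proof. by rewrite /dsrc; case: ifP => _; [exact: tgt_gt0|exact: src_gt0]. Qed.

Lemma dtgt_gt0 d v n : dtgt d = Some (v, n) -> (0 < n)%N.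
Proof. by rewrite /dtgt; case: ifP => _; [exact: src_gt0|exact: tgt_gt0]. Qed.

Lemma dsrc_flip d : dsrc (dflip d) = dtgt d.
Proof. by rewrite /dsrc /dtgt /=; case: d.2. Qed.

Lemma dtgt_flip d : dtgt (dflip d) = dsrc d.
Proof. by rewrite /dsrc /dtgt /=; case: d.2. Qed.

Lemma dratio_flip d : dratio (dflip d) = (dratio d)^-1.
Proof. by rewrite /dratio dsrc_flip dtgt_flip invf_div. Qed.

Lemma walk_cat u s t w : walk u (s ++ t) w <-> exists2 v, walk u s v & walk v t w.
Proof.
elim: s u => [|d s IH] u /=; first by split=> [ut|[v -> //]]; exists u.
split=> [[m [v [n [du dv /IH[x sx tx]]]]]|[x [m [v [n [du dv sx]]]] tx]].
  by exists x => //; exists m, v, n.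
by exists m, v, n; split=> //; apply/IH; exists x.
Qed.

Lemma walk_flip u s w : walk u s w -> walk w (rev (map dflip s)) u.
Proof.
elim: s u => [|d s IH] u /=; first by move=> ->.
move=> [m [v [n [du dv /IH sw]]]]; rewrite rev_cons -cats1; apply/walk_cat.
by exists v => //=; exists n, u, m; rewrite dsrc_flip dtgt_flip.
Qed.

Lemma ratio_flip s : ratio (rev (map dflip s)) = (ratio s)^-1.
Proof.
rewrite /ratio (perm_big (map dflip s)) /=; last by rewrite perm_rev.
rewrite big_map; elim: s => [|d s IH]; first by rewrite !big_nil invr1.
by rewrite !big_cons IH dratio_flip [RHS]invfM.
Qed.

Lemma ratio_cat s t : ratio (s ++ t) = ratio s * ratio t.
Proof. exact: big_cat. Qed.

Lemma ratio_neq0 u s w : walk u s w -> ratio s != 0.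
Proof.
elim: s u => [|d s IH] u /=; first by rewrite /ratio big_nil oner_eq0.
move=> [m [v [n [du dv /IH sw]]]]; rewrite /ratio big_cons mulf_neq0 // /dratio du dv /=.
by rewrite mulf_neq0 ?invr_neq0 // pnatr_eq0 -lt0n; [exact: dsrc_gt0 du|exact: dtgt_gt0 dv].
Qed.

(** Only the equations at darts of the walk are assumed, so that the lemma applies to a potential
    known on a subgraph. *)
Lemma walk_potential (a : V -> rat) u s w :
  (forall d x m y n, d \in s -> dsrc d = Some (x, m) -> dtgt d = Some (y, n) ->
     a x * m%:R = a y * n%:R) ->
  walk u s w -> a u * ratio s = a w.
Proof.
elim: s u => [|d s IH] u pa /=; first by move=> ->; rewrite /ratio big_nil mulr1.
move=> [m [v [n [du dv sw]]]]; rewrite /ratio big_cons -/(ratio s) mulrA.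
rewrite /dratio du dv /= mulrA (pa _ _ _ _ _ (mem_head _ _) du dv) mulfK; last first.
  by rewrite pnatr_eq0 -lt0n; exact: dtgt_gt0 dv.
by apply: IH sw => d' x k y l d's; apply: pa; rewrite in_cons d's orbT.
Qed.

Lemma walk_labels d0 u s w : walk u s w -> exists (v : nat -> V) (out inn : nat -> nat),
  [/\ v 0%N = u, v (size s) = w & forall i, (i < size s)%N ->
    dsrc (nth d0 s i) = Some (v i, out i) /\ dtgt (nth d0 s i) = Some (v i.+1, inn i)].
Proof.
elim: s u => [|d s IH] u /=; first by move=> ->; exists (fun=> w), (fun=> 0%N), (fun=> 0%N).
move=> [m [x [n [du dv /IH[v [out [inn [v0 vn vE]]]]]]]].
exists (fun i => if i is j.+1 then v j else u), (fun i => if i is j.+1 then out j else m),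
  (fun i => if i is j.+1 then inn j else n); split=> // -[|i] /=; last exact: vE.
by rewrite v0.
Qed.

Hypothesis Gam_balanced : forall (V' : set V) (E' : set E),
  nnd_cycle (subgraph Gam V' E') -> balanced_nnd_cycle (subgraph Gam V' E').

Lemma restrict_end_some (V' : set V) v n (vV : v \in V') :
  restrict_end V' (Some (v, n)) = Some (exist (fun x => x \in V') v vV : V', n).
Proof. by rewrite /restrict_end insubT. Qed.

(** The vertices and edges of the walk form a subgraph which becomes a directed cycle after
    reversing some edges. Being balanced, it carries a potential without zeros, and following it
    around the walk gives ratio 1. *)
Lemma simple_closed_walk_ratio d0 u s (v : nat -> V) (out inn : nat -> nat) :
  (0 < size s)%N -> v (size s) = v 0%N ->
  (forall i, (i < size s)%N ->
    dsrc (nth d0 s i) = Some (v i, out i) /\ dtgt (nth d0 s i) = Some (v i.+1, inn i)) ->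
  (forall i j, (i < size s)%N -> (j < size s)%N -> v i = v j -> i = j) ->
  uniq (map fst s) -> walk u s u -> ratio s = 1.
Proof.
move=> s0 vn vE v_inj e_uniq su.
pose V' : set V := [set x | exists2 i, (i < size s)%N & x = v i]%classic.
pose E' : set E := [set x | exists2 i, (i < size s)%N & x = (nth d0 s i).1]%classic.
have vV i : (i < size s)%N -> v i \in V' by move=> ?; rewrite inE; exists i.
have eE i : (i < size s)%N -> (nth d0 s i).1 \in E' by move=> ?; rewrite inE; exists i.
pose vI (i : 'I_(size s)) : V' := exist (fun x => x \in V') (v i) (vV i (ltn_ord i)).
pose eI (i : 'I_(size s)) : E' :=
  exist (fun x => x \in E') (nth d0 s i).1 (eE i (ltn_ord i)).
pose sub := subgraph Gam V' E'.
(* The edges to reverse are those travelled from target to source. *)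
pose r : pred E' := fun e => has (fun d : dart => (d.1 == val e) && d.2) s.
have e_inj i j : (i < size s)%N -> (j < size s)%N ->
    (nth d0 s i).1 = (nth d0 s j).1 -> i = j.
  move=> si sj; rewrite -!(nth_map d0 d0.1 fst) // => /eqP.
  by rewrite nth_uniq ?size_map // => /eqP.
have rE i : r (eI i) = (nth d0 s i).2.
  apply/hasP/idP => [[d ds /andP[/eqP di d2]]|i2]; last first.
    by exists (nth d0 s i); [exact: mem_nth|rewrite /= eqxx].
  have <- : d = nth d0 s i => //.
  rewrite -(nth_index d0 ds) in di *; congr nth; apply: e_inj => //.
  by rewrite index_mem.
have vS (i : 'I_(size s)) : v i.+1 = v (ordS i).
  rewrite /=; have [ilt|] := ltnP i.+1 (size s); first by rewrite modn_small.
  move=> ile; have -> : i.+1 = size s by apply/eqP; rewrite eqn_leq ile ltn_ord.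
  by rewrite modnn.
have srcE i : src (reverse_edges sub r) (eI i) = Some (vI i, out i).
  have [di _] := vE i (ltn_ord i).
  have -> : src (reverse_edges sub r) (eI i) = restrict_end V' (dsrc (nth d0 s i)).
    by rewrite /= rE /dsrc; case: ((nth d0 s i).2).
  by rewrite di (restrict_end_some _ (vV i (ltn_ord i))).
have tgtE i : tgt (reverse_edges sub r) (eI i) = Some (vI (ordS i), inn i).
  have [_ di] := vE i (ltn_ord i).
  have -> : tgt (reverse_edges sub r) (eI i) = restrict_end V' (dtgt (nth d0 s i)).
    by rewrite /= rE /dtgt; case: ((nth d0 s i).2).
  by rewrite di vS (restrict_end_some _ (vV _ (ltn_ord (ordS i)))).
have cyc : nnd_cycle sub.
  exists V', E', (reverse_edges sub r); split; last first.
    exists r, id, id; split; [by exists id|by exists id| |] => e.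
      by case: (src _ e) => [[]|].
    by case: (tgt _ e) => [[]|].
  exists (size s), vI, eI, (fun i => out i), (fun i => inn i); split=> //.
  - apply: inj_surj_bijective => [i j /(congr1 val) /= vij|[x xV]].
      by apply: val_inj; exact: (v_inj _ _ (ltn_ord i) (ltn_ord j) vij).
    have := xV; rewrite inE => -[i si xi]; exists (Ordinal si).
    by apply: val_inj; rewrite /= xi.
  - apply: inj_surj_bijective => [i j /(congr1 val) /= vij|[x xE]].
      by apply: val_inj; exact: (e_inj _ _ (ltn_ord i) (ltn_ord j) vij).
    have := xE; rewrite inE => -[i si xi]; exists (Ordinal si).
    by apply: val_inj; rewrite /= xi.
(* Balance is witnessed by some directed cycle, perhaps with other reversals than [r]. Passing to a
   potential removes this ambiguity, as potentials survive isomorphisms and reversals. *)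
have [V2 [E2 [Gam2 [/cycle_potential[a a0 pa] [r2 [f [g [_ _ fs ft]]]]]]]] :=
  Gam_balanced cyc.
have /potential_reverse pf : potential (reverse_edges sub r2) (a \o f).
  exact: potential_iso fs ft pa.
have {pf} pr : potential (reverse_edges sub r) (a \o f) by apply/potential_reverse.
(* The value 1 outside [V'] only keeps [b] nonzero; the walk stays inside [V']. *)
pose b x : rat := if insub x is Some x' then a (f (x' : V')) else 1.
have bE (x' : V') : b (val x') = a (f x') by rewrite /b valK.
have b0 x : b x != 0 by rewrite /b; case: insubP => [x' _ _|_]; rewrite ?oner_eq0.
suff h : b u * ratio s = b u by apply: (mulfI (b0 u)); rewrite mulr1.
apply: walk_potential su => d x m y n ds dx dy.
have [i di] : exists i : 'I_(size s), d = nth d0 s i.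
  have id_lt : (index d s < size s)%N by rewrite index_mem.
  by exists (Ordinal id_lt); rewrite /= nth_index.
have [di1 di2] := vE i (ltn_ord i); rewrite di di1 in dx; rewrite di di2 in dy.
case: dx => <- <-; case: dy => <- <-; rewrite vS.
have -> : b (v i) = a (f (vI i)) by exact: (bE (vI i)).
have -> : b (v (ordS i)) = a (f (vI (ordS i))) by exact: (bE (vI (ordS i))).
exact: (pr _ _ _ _ _ (srcE i) (tgtE i)).
Qed.

(** Induction on length. A repeated vertex splits the walk into two shorter closed walks; without
    one, either the edges are distinct and the walk is a cycle, or it goes along an edge and
    straight back. *)
Lemma closed_walk_ratio u s : walk u s u -> ratio s = 1.
Proof.
have [n] := ubnP (size s); elim: n u s => [//|n IH] u s; rewrite ltnS => sn su.
have [s0|s0] := posnP (size s); first by rewrite (size0nil s0) /ratio big_nil.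
have [d0 _] : exists d0 : dart, d0 \in s.
  by case: s s0 {sn su} => // d s _; exists d; exact: mem_head.
have [v [out [inn [v0 vn vE]]]] := walk_labels d0 su.
have [v_inj|] := pselect (forall i j, (i < j)%N -> (j < size s)%N -> v i <> v j); last first.
  move=> /existsNP[i /existsNP[j /not_implyP[ij /not_implyP[js /contrapT vij]]]].
  (* The piece [s2] between the two visits is closed, and so is the rest [s1 ++ s3]. *)
  pose s1 := take i (take j s); pose s2 := drop i (take j s); pose s3 := drop j s.
  have sz : size (take j s) = j by rewrite size_takel // ltnW.
  have sE : s = (s1 ++ s2) ++ s3 by rewrite !cat_take_drop.
  have := su; rewrite {1}sE => /walk_cat[b /walk_cat[a w1 w2] w3].
  have ba : b = a.
    have := w3; rewrite /s3 (drop_nth d0 js) /= => -[m [x [k [db _ _]]]].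
    have := w2; rewrite /s2 (drop_nth d0) ?sz // /= nth_take // => -[m' [x' [k' [da _ _]]]].
    have [] := vE j js; rewrite db => -[-> _] _.
    by have [] := vE i (ltn_trans ij js); rewrite da => -[-> _] _.
  rewrite ba in w2 w3; rewrite sE !ratio_cat mulrAC -ratio_cat.
  rewrite (IH _ _ _ w2) ?(IH u (s1 ++ s3)) ?mulr1 //.
  - by rewrite size_cat /s1 /s3 size_drop size_takel ?sz ?(ltnW ij) //; lia.
  - by apply/walk_cat; exists a.
  - by rewrite /s2 size_drop sz; lia.
have {}v_inj i j : (i < size s)%N -> (j < size s)%N -> v i = v j -> i = j.
  move=> si sj vij; case: (ltngtP i j) => // ij.
    by case: (v_inj i j ij sj).
  by case: (v_inj j i ij si).
have vn0 : v (size s) = v 0%N by rewrite v0 vn.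
have [e_uniq|] := boolP (uniq (map fst s)).
  exact: (simple_closed_walk_ratio s0 vn0 vE v_inj e_uniq su).
move=> /(uniqPn d0.1)[i [j [ij]]]; rewrite size_map => js.
have si := ltn_trans ij js; rewrite !(nth_map d0) // => eij.
have [] := vE i si; have [] := vE j js.
case dj : (nth d0 s j) eij => [e bj]; case di : (nth d0 s i) => [e' bi] /= eE.
(* An edge used twice in the same direction would give two visits to its starting vertex, so the
   directions are opposite. *)
rewrite /dsrc /dtgt /= -eE; case: (eqVneq bi bj) => [->|bij].
  move=> -> _ [vij _] _.
  by have := v_inj _ _ si js (esym vij) => ji; rewrite ji ltnn in ij.
have -> : bj = ~~ bi by case: bi bj bij {di dj} => [] [].
move=> h1 h2 h3 h4.
have vi1 : v i.+1 = v j.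
  by move: h1 h4; case: (bi) => /= -> [].
have vj1 : v j.+1 = v i.
  by move: h2 h3; case: (bi) => /= -> [].
(* The second use starts where the first ends and ends where the first starts; as vertices do not
   repeat, the uses are consecutive and make up the whole walk. *)
have j1 : j = i.+1 by apply: v_inj => //; exact: leq_ltn_trans js.
have [j1s|sj] := ltnP j.+1 (size s).
  by have := v_inj _ _ j1s si vj1; lia.
have sj' : size s = j.+1 by apply/eqP; rewrite eqn_leq sj js.
have i0 : i = 0%N by apply: v_inj => //; rewrite -vj1 -sj'.
have s2 : s = [:: (e', bi); (e', ~~ bi)].
  move: sj' di dj; rewrite j1 i0; case: (s) => [//|x [//|y [|//]]] /= _ -> ->.
  by rewrite eE; have -> : bj = ~~ bi by case: (bi) (bj) bij => [] [].
rewrite s2 /ratio big_cons big_seq1 -[(e', ~~ bi)]/(dflip (e', bi)) dratio_flip divff //.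
by have := ratio_neq0 su; rewrite s2 /ratio big_cons mulf_eq0 negb_or => /andP[].
Qed.

Definition reachable v0 v := exists s, walk v0 s v.

Lemma reachable_edge v0 e u m w n : src Gam e = Some (u, m) -> tgt Gam e = Some (w, n) ->
  reachable v0 u <-> reachable v0 w.
Proof.
move=> su tw; split=> -[s sE].
  by exists (s ++ [:: (e, false)]); apply/walk_cat; exists u => //; exists m, w, n.
by exists (s ++ [:: (e, true)]); apply/walk_cat; exists w => //; exists n, u, m.
Qed.

(** The value at [v] is the ratio of a chosen walk from [v0] to [v], and 0 if there is none. The
    equation at an edge holds because going to one end, across, and back along the walk chosen for
    the other end is a closed walk. *)
Lemma rational_potential v0 :
  exists2 a : V -> rat, a v0 != 0 & potential Gam a.
Proof.
pose a v : rat := if pselect (reachable v0 v) is left h then ratio (sval (cid h)) else 0.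
exists a.
  rewrite /a; case: pselect => [h|[]]; last by exists [::].
  exact: ratio_neq0 (svalP (cid h)).
move=> e u m w n su tw; rewrite /a; have ruw := reachable_edge v0 su tw.
case: pselect => [ru|nru]; case: pselect => [rw|nrw]; last by rewrite !mul0r.
- case: (cid ru) (cid rw) => s /= sE [t /= tE].
  have tr0 := ratio_neq0 tE; have n0 : n%:R != 0 :> rat.
    by rewrite pnatr_eq0 -lt0n; exact: tgt_gt0 tw.
  have : walk v0 (s ++ (e, false) :: rev (map dflip t)) v0.
    apply/walk_cat; exists u => //; exists m, w, n; split=> //; exact: walk_flip.
  move=> /closed_walk_ratio; rewrite ratio_cat {2}/ratio big_cons -/(ratio _) ratio_flip.
  rewrite /dratio /dsrc /dtgt /= su tw /= => h.
  have -> : ratio t * n%:R = ratio t * n%:R * (ratio s * (m%:R / n%:R / ratio t)).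
    by rewrite h mulr1.
  by field; rewrite n0 tr0.
- by case: nrw; apply/ruw.
- by case: nru; apply/ruw.
Qed.

(** With finitely many vertices, the product of all denominators clears them. *)
Lemma integer_potential v0 : finite_set [set: V]%classic ->
  exists2 a : V -> int, a v0 != 0 & potential Gam a.
Proof.
move=> Vfin; have [b b0 pb] := rational_potential v0.
pose d := fset_set [set: V]%classic.
have dV v : v \in d by rewrite in_fset_set // inE.
pose D : int := \prod_(w <- d) denq (b w).
have D0 : D != 0 by rewrite prodf_seq_neq0; apply/allP => w _; exact: denq_neq0.
have [a aE] : exists a : V -> int, forall v, (a v)%:~R = b v * D%:~R.
  exists (fun v => numq (b v) * \prod_(w <- (d `\ v)%fset) denq (b w)) => v.
  by rewrite /D (big_fsetD1 v (dV v)) /= !rmorphM /= numqE mulrA.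
exists a => [|e u m w n su tw].
  by rewrite -(intr_eq0 rat) aE mulf_neq0 // intr_eq0.
apply: (@intr_inj rat); rewrite !rmorphM /= !aE !rmorph_nat.
by rewrite mulrAC (pb e _ _ _ _ su tw) mulrAC.
Qed.
End Walks.

(** * Kernel vectors and components in equilibrium *)

Section Components.
Variables (V E : choiceType) (Gam : multiquiver V E).

Lemma linked_incident x v e : incident Gam v e ->
  linked Gam x (inl v) <-> linked Gam x (inr e).
Proof.
move=> ve; split=> h; apply: rst_trans h _; last apply: rst_sym; exact: rst_step.
Qed.

Lemma src_incident e v n : src Gam e = Some (v, n) -> incident Gam v e.
Proof. by move=> se; rewrite /incident /has_vertex se /= eqxx. Qed.

Lemma tgt_incident e v n : tgt Gam e = Some (v, n) -> incident Gam v e.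
Proof. by move=> se; rewrite /incident /has_vertex se /= eqxx orbT. Qed.

(** An integral potential on the component, extended by zero, is a kernel vector: inside, every edge
    has two ends; an edge outside has no end in the component. *)
Lemma gamma_not_inj_of_equilibrium x : in_equilibrium (component Gam x) ->
  exists2 a, a != 0 & gamma Gam a = 0.
Proof.
set Vx := [set v | linked Gam x (inl v)]%classic; set Ex := [set e | linked Gam x (inr e)]%classic.
move=> [Vfin no_leaf bal].
(* If the component is given by an edge, that edge is not a leaf and so supplies a vertex. *)
have [v0] : exists v0 : Vx, True.
  case: x @Vx @Ex Vfin no_leaf bal => [v|e] Vx Ex Vfin no_leaf bal.
    have vV : v \in Vx by rewrite inE; exact: rst_refl.
    by exists (exist (fun x => x \in Vx) v vV).
  have eE : e \in Ex by rewrite inE; exact: rst_refl.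
  have := no_leaf (exist (fun x => x \in Ex) e eE); rewrite /leaf negb_or => /andP[].
  by case: (src _ _) => [[v n]|] //= _ _; exists v.
move=> _; have [a a0 pa] := integer_potential bal v0 Vfin.
pose d := fset_set [set: Vx]%classic.
have dV v : v \in d by rewrite in_fset_set // inE.
pose a' : {malg V} := \sum_(v <- d) << a v *g val v >>.
have a'E (v : Vx) : a'@_(val v) = a v.
  rewrite raddf_sum /= (big_fsetD1 v (dV v)) /= mcoeffUU big1_fset ?addr0 // => w.
  by rewrite in_fsetD1 => /andP[wv _] _; rewrite mcoeffU (inj_eq val_inj) (negbTE wv).
have a'0 v : v \notin Vx -> a'@_v = 0.
  move=> vV; rewrite raddf_sum /= big1 // => w _; rewrite mcoeffU.
  by case: eqP => // wv; rewrite -wv (valP w) in vV.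
exists a'.
  by apply/eqP => a'eq; move: a0; rewrite -a'E a'eq mcoeff0 eqxx.
apply/malgP => e; rewrite mcoeff0 gamma_end_val; apply/eqP; rewrite subr_eq0; apply/eqP.
have [eE|eE] := boolP (e \in Ex).
  pose e' : Ex := exist (fun x => x \in Ex) e eE.
  have := no_leaf e'; rewrite /leaf negb_or => /andP[].
  case se : (src _ e') => [[u m]|] //; case te : (tgt _ e') => [[w n]|] // _ _.
  have /restrict_endP /= -> := se; have /restrict_endP /= -> := te.
  rewrite /end_val !a'E; exact: esym (pa _ _ _ _ _ se te).
have out v n : incident Gam v e -> end_val (mcoeff^~ a') (Some (v, n)) = 0.
  move=> ve /=; rewrite a'0 ?mul0r //; apply: contra eE; rewrite !inE.
  by move/(linked_incident x ve).
case te : (tgt Gam e) => [[w n]|]; case se : (src Gam e) => [[u m]|] //.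
- by rewrite (out w n (tgt_incident te)) (out u m (src_incident se)).
- by rewrite (out w n (tgt_incident te)).
- by rewrite (out u m (src_incident se)).
Qed.

Lemma equilibrium_of_kernel (a : {malg V}) v0 : gamma Gam a = 0 -> a@_v0 != 0 ->
  in_equilibrium (component Gam (inl v0)).
Proof.
move=> ga a0; have ge e : end_val (mcoeff^~ a) (tgt Gam e) = end_val (mcoeff^~ a) (src Gam e).
  by apply/eqP; rewrite -subr_eq0 -gamma_end_val ga mcoeff0.
(* Nonvanishing, extended to edges so that it propagates along incidences; for an edge it includes
   the presence of both ends, which rules out leaves. *)
pose P (y : V + E) : Prop := match y with
  | inl v => is_true (a@_v != 0)
  | inr e => exists u m w n, [/\ src Gam e = Some (u, m), tgt Gam e = Some (w, n),
                                 a@_u != 0 & a@_w != 0] end.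
have nz (v : V) (n : nat) : (0 < n)%N -> (end_val (mcoeff^~ a) (Some (v, n)) != 0) = (a@_v != 0).
  by move=> n0; rewrite /= mulf_eq0 negb_or natz -lt0n n0 andbT.
have step v e : incident Gam v e -> P (inl v) <-> P (inr e).
  move=> ve; split=> /= [av|[u [m [w [n [su tw au aw]]]]]]; last first.
    by move: ve; rewrite /incident /has_vertex su tw /= => /orP[] /eqP[<-].
  have endP (x y : option (V * nat)) : (forall u m, x = Some (u, m) -> (0 < m)%N) ->
      (forall u m, y = Some (u, m) -> (0 < m)%N) ->
      has_vertex x v -> end_val (mcoeff^~ a) x = end_val (mcoeff^~ a) y ->
      exists u m w n, [/\ x = Some (u, m), y = Some (w, n), a@_u != 0 & a@_w != 0].
    case: x => [[u m]|] //= xm ym /eqP[uv] xy; rewrite -uv in av.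
    have um0 := xm _ _ erefl; have := nz u m um0; rewrite av => /=; rewrite xy.
    case: y ym {xy} => [[w n]|] ym; last by [].
    by rewrite nz ?(ym _ _ erefl) // => aw; exists u, m, w, n.
  case/orP: ve => ve.
    exact: (endP _ _ (@src_gt0 _ _ Gam e) (@tgt_gt0 _ _ Gam e) ve (esym (ge e))).
  have [w [n [u [m [tw su aw au]]]]] :=
    endP _ _ (@tgt_gt0 _ _ Gam e) (@src_gt0 _ _ Gam e) ve (ge e).
  by exists u, m, w, n.
have Plinked y z : linked Gam y z -> P y <-> P z.
  elim=> [[v|e] [w|e'] //= |//|y' z' _ [? ?] //|y' z' t _ [? ?] _ [? ?]]; last by split; auto.
  exact: step.
have Pv v : linked Gam (inl v0) (inl v) -> a@_v != 0.
  by move=> /Plinked[+ _]; apply.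
split.
(* All vertices of the component lie in the support of [a], which is finite. *)
- have := @finite_preimage _ _ [set` msupp a]%classic
    (val : [set v | linked Gam (inl v0) (inl v)]%classic -> V) (in2W val_inj) (finite_fset _).
  apply: sub_finite_set => v _ /=; rewrite -mcoeff_neq0; apply: Pv.
  by have := valP v; rewrite inE.
- move=> e; have el : linked Gam (inl v0) (inr (val e)) by have := valP e; rewrite inE.
  have [+ _] := Plinked _ _ el => /(_ a0) /= [u [m [w [n [su tw _ _]]]]].
  have ul : u \in [set v | linked Gam (inl v0) (inl v)]%classic.
    by rewrite inE; apply/(linked_incident _ (src_incident su)).
  have wl : w \in [set v | linked Gam (inl v0) (inl v)]%classic.
    by rewrite inE; apply/(linked_incident _ (tgt_incident tw)).
  by rewrite /leaf /= su tw (restrict_end_some _ ul) (restrict_end_some _ wl).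
(* The kernel vector restricts to a potential without zeros, first on the component and then on its
   subgraph. *)
move=> V' E'; apply: (potential_balanced (a := fun v => (a@_(val (val v)))%:~R)).
  move=> v; rewrite intr_eq0; apply: Pv; have := valP (val v).
  by rewrite inE.
apply: (potential_subgraph (a := fun v => (a@_(val v))%:~R)).
apply: (potential_subgraph (a := fun v => (a@_v)%:~R)).
move=> e u m w n su tw; have := ge e; rewrite su tw /= => h.
by rewrite -!(rmorph_nat (intr : int -> rat)) -!rmorphM /= h.
Qed.

Lemma gamma_inj_equilibriumP :
  injective (gamma Gam) <-> forall x, ~ in_equilibrium (component Gam x).
Proof.
split=> [/gamma_injP gi x /gamma_not_inj_of_equilibrium[a /eqP a0 /gi//]|ne].
apply/gamma_injP => a ga; apply/malgP => v; rewrite mcoeff0; apply/eqP/negPn/negP => av.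
exact: (ne _ (equilibrium_of_kernel ga av)).
Qed.
End Components.

Theorem theorem4p11 (K : fieldType) (charK : [pchar K] =i pred0)
    (V E : choiceType) (Gam : multiquiver V E) :
  [<-> injective (canonical_rep charK Gam);
       injective (gamma Gam);
       max_comm_subalgebra (mq_R charK Gam);
       forall x : V + E, ~ in_equilibrium (component Gam x)].
Proof.
(* Each implication in the cycle goes through injectivity of [gamma]. *)
tfae.
- exact: gamma_inj_of_canonical_rep.
- exact: mq_R_max_comm.
- by move=> /gamma_inj_of_mq_R_max_comm /gamma_inj_equilibriumP.
- by move=> /gamma_inj_equilibriumP /canonical_rep_inj.
Qed.
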